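(* Let $G$ be a group and let $L,N$ be normal subgroups of $G$ with $L\geqslant N$. Assume that there exists $q\in\mathbb{Z}$, $q\geq 2$, such that one of the following holds: (a$_q$) $N=\gamma_q(G)$ and $L=\gamma_{q-1}(G)$; or (b$_q$) $N\geqslant \gamma_q(G)$, $L=\gamma_{q-1}(G)N$, and $G$ admits a presentation $(F\mid R)$ with $R\leqslant \gamma_q(F)$. Assume that $\mathcal{W}(G,L,N)$ is finite dimensional and set $\ell=\dim_{\mathbb{R}}\mathcal{W}(G,L,N)$. Then there exist maps $\Phi\colon [G,N]\to\mathbb{Z}^{\ell}$ and $\Psi\colon\mathbb{Z}^{\ell}\to[G,N]$ such that: (1) $\Phi\colon ([G,N],d_{\mathrm{scl}_{G,N}})\to(\mathbb{Z}^\ell,\|\cdot\|_1)$ and $\Psi\colon(\mathbb{Z}^\ell,\|\cdot\|_1)\to([G,N],d_{\mathrm{scl}_{G,N}})$ are pre-coarse homomorphisms; (2) the image $\Psi(\mathbb{Z}^\ell)$ is $d_{\mathrm{scl}_{G,L}}$-bounded; (3) $\Psi\colon(\mathbb{Z}^\ell,\|\cdot\|_1)\to([G,N],d_{\mathrm{scl}_{G,N}})$ is a quasi-isometric embedding; (4) for every $d_{\mathrm{scl}_{G,L}}$-bounded set $A\subseteq[G,N]$, the restriction $\Phi|_A\colon (A,d_{\mathrm{scl}_{G,N}})\to(\mathbb{Z}^\ell,\|\cdot\|_1)$ is a quasi-isometric embedding; (5) for every $d_{\mathrm{scl}_{G,L}}$-bounded set $A\subseteq[G,N]$, $\sup_{y\in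 A} d_{\mathrm{scl}_{G,N}}(y,(\Psi\circ\Phi)(y))<\infty$; (6) $\sup\{\|(\Phi\circ\Psi)(\vec m)-\vec m\|_1 : \vec m\in\mathbb{Z}^\ell\}<\infty$; (7) $\Psi(\mathbb{Z}^\ell)$ represents the coarse kernel of $\iota_{(G,L,N)}$, i.e. $\Psi(\mathbb{Z}^\ell)$ is $d_{\mathrm{scl}_{G,L}}$-bounded and for every $d_{\mathrm{scl}_{G,L}}$-bounded set $B\subseteq[G,N]$ there is $D\geq 0$ such that every $b\in B$ satisfies $\inf_{a\in\Psi(\mathbb{Z}^\ell)} d_{\mathrm{scl}_{G,N}}(a,b)\leq D$. In particular, regarding $\Psi$ as a map $\mathbb{Z}^\ell\to\Psi(\mathbb{Z}^\ell)$, the maps $\Phi|_{\Psi(\mathbb{Z}^\ell)}$ and $\Psi$ are mutually coarse inverse coarse isomorphisms between $(\Psi(\mathbb{Z}^\ell),d_{\mathrm{scl}_{G,N}})$ and $(\mathbb{Z}^\ell,\|\cdot\|_1)$. Furthermore, $\Phi$ and $\Psi$ may be chosen so that in addition $\Phi\circ\Psi=\mathrm{id}_{\mathbb{Z}^\ell}$.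
   Context: For $g,h$ in a group, $[g,h]=ghg^{-1}h^{-1}$. The lower central series is $\gamma_1(G)=G$, $\gamma_{k+1}(G)=[G,\gamma_k(G)]$. A presentation $(F\mid R)$ of $G$ means: $F$ is a free group, $R$ a normal subgroup of $F$, and $G\cong F/R$. For a normal subgroup $N$ of $G$, $[G,N]$ is the subgroup generated by the simple commutators $[g,x]$ ($g\in G$, $x\in N$); $\mathrm{cl}_{G,N}(y)$ is the least number of simple commutators whose product is $y\in[G,N]$ ($\mathrm{cl}_{G,N}(e)=0$); $\mathrm{scl}_{G,N}(y)=\lim_{n\to\infty}\mathrm{cl}_{G,N}(y^n)/n$. On $[G,N]$ put $d_{\mathrm{scl}_{G,N}}(y_1,y_2)=\mathrm{scl}_{G,N}(y_1^{-1}y_2)$; since $[G,N]\subseteq[G,L]$, $d_{\mathrm{scl}_{G,L}}$ is defined on $[G,N]$ in the same way. The map $\iota_{(G,L,N)}$ is the identity map $([G,N],d_{\mathrm{scl}_{G,N}})\to([G,N],d_{\mathrm{scl}_{G,L}})$. A map $\psi\colon H\to\mathbb{R}$ is homogeneous if $\psi(h^n)=n\psi(h)$ for all $h\in H$, $n\in\mathbb{Z}$; its defect is $\mathscr{D}(\psi)=\sup_{h_1,h_2}|\psi(h_1h_2)-\psi(h_1)-\psi(h_2)|$ and $\psi$ is a quasimorphism if $\mathscr{D}(\psi)<\infty$. $\mathrm{Q}(N)^G$ is the real vector space of homogeneous quasimorphisms $\nu$ on $N$ with $\nu(gxg^{-1})=\nu(x)$ for all $g\in G,x\in N$; $\mathrm{H}^1(N)^G$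 is the space of such $G$-invariant homomorphisms $N\to\mathbb{R}$. With $i^*\colon\mathrm{Q}(L)^G\to\mathrm{Q}(N)^G$ the restriction, $\mathcal{W}(G,L,N)=\mathrm{Q}(N)^G/(\mathrm{H}^1(N)^G+i^*\mathrm{Q}(L)^G)$. Coarse notions (for sets $X,Y$ with functions $d_X,d_Y$ to $[0,\infty)$): a subset is $d$-bounded if its $d$-diameter is finite; $\alpha\colon X\to Y$ is controlled if for each $S$ there is $T$ with $d_X(x,x')\le S\Rightarrow d_Y(\alpha x,\alpha x')\le T$; $\alpha$ is a quasi-isometric embedding if there are $C_1,C_2>0$, $D_1,D_2\ge0$ with $C_1d_X(x,x')-D_1\le d_Y(\alpha x,\alpha x')\le C_2 d_X(x,x')+D_2$; $\alpha,\beta$ are close if $\sup_x d_Y(\alpha x,\beta x)<\infty$; two controlled maps are coarse inverse if both compositions are close to the identities. For groups with such functions, $\alpha$ is a pre-coarse homomorphism if $\sup_{g,g'}d(\alpha(gg'),\alpha(g)\alpha(g'))<\infty$; a coarse homomorphism is a controlled pre-coarse homomorphism. $\mathbb{Z}^\ell$ carries the $\ell^1$-norm; $\mathbb{Z}^0=\{0\}$. *)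

(* Defs.v *)
From HB Require Import structures.
From mathcomp Require Import all_boot all_order all_algebra.
From mathcomp Require Import all_classical all_reals all_analysis.
From mathcomp Require Import Rstruct Rstruct_topology.
From Stdlib Require Import Rdefinitions.

Set Implicit Arguments.
Unset Strict Implicit.
Unset Printing Implicit Defensive.

Import Order.TTheory GRing.Theory Num.Theory.

Local Open Scope ring_scope.

Notation RR := Rdefinitions.R.

Section GroupDefs.
Variable G : groupType.
Implicit Types (x y g h : G) (A N L : G -> Prop).

Definition comm g h : G := (g * h * g^-1 * h^-1)%g.

Definition zpow x (z : int) : G :=
  match z with Posz n => (x ^+ n)%g | Negz n => ((x ^+ n.+1)^-1)%g end.

Definition is_subgroup A : Prop :=
  A 1%g /\ (forall x y, A x -> A y -> A (x * y)%g) /\ (forall x, A x -> A (x^-1)%g).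

Definition is_normal A : Prop :=
  is_subgroup A /\ forall g x, A x -> A (g * x * g^-1)%g.

Inductive gen (A : G -> Prop) : G -> Prop :=
| gen_in x : A x -> gen A x
| gen_one : gen A 1%g
| gen_mul x y : gen A x -> gen A y -> gen A (x * y)%g
| gen_inv x : gen A x -> gen A (x^-1)%g.

Definition commGN N : G -> Prop :=
  gen (fun y => exists g x, N x /\ y = comm g x).

(* lower central series: lcs n = gamma_{n+1}(G) *)
Fixpoint lcs (n : nat) : G -> Prop :=
  match n with
  | 0 => fun _ => True
  | n'.+1 => commGN (lcs n')
  end.

Definition gamma (k : nat) : G -> Prop := lcs k.-1.

Definition prod_comm (s : seq (G * G)) : G :=
  foldr (fun p acc => (comm p.1 p.2 * acc)%g) 1%g s.

Definition cl N y : RR :=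
  inf [set (n%:R : RR) | n in
        [set n : nat | exists s : seq (G * G),
           size s = n /\ (forall p, p \in s -> N p.2) /\ prod_comm s = y]].

Definition scl N y : RR := limn (fun n : nat => cl N (y ^+ n)%g / n%:R).

Definition dscl N y1 y2 : RR := scl N (y1^-1 * y2)%g.

Definition homogeneous_on N (psi : G -> RR) : Prop :=
  forall h (n : int), N h -> psi (zpow h n) = n%:~R * psi h.

Definition quasimorphism_on N (psi : G -> RR) : Prop :=
  exists C : RR, forall h1 h2, N h1 -> N h2 ->
    `|psi (h1 * h2)%g - psi h1 - psi h2| <= C.

Definition G_invariant_on N (psi : G -> RR) : Prop :=
  forall g x, N x -> psi (g * x * g^-1)%g = psi x.

(* Q(N)^G (functions are only considered on N) *)
Definition QG N (psi : G -> RR) : Prop :=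
  homogeneous_on N psi /\ quasimorphism_on N psi /\ G_invariant_on N psi.

Definition H1G N (psi : G -> RR) : Prop :=
  (forall x y, N x -> N y -> psi (x * y)%g = psi x + psi y) /\ G_invariant_on N psi.

(* dim_R W(G,L,N) = l, where
   W(G,L,N) = Q(N)^G / (H^1(N)^G + i^* Q(L)^G); functions on N are
   identified when they agree on N.  This says: there are l elements of
   Q(N)^G whose classes form a basis of W(G,L,N). *)
Definition dimW L N (l : nat) : Prop :=
  exists nu : 'I_l -> G -> RR,
    (forall i, QG N (nu i)) /\
    (forall (c : 'I_l -> RR) (h mu : G -> RR), H1G N h -> QG L mu ->
       (forall x, N x -> \sum_i c i * nu i x = h x + mu x) ->
       forall i, c i = 0) /\
    (forall psi, QG N psi -> exists (c : 'I_l -> RR) (h mu : G -> RR),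
       H1G N h /\ QG L mu /\
       forall x, N x -> psi x = \sum_i c i * nu i x + h x + mu x).

End GroupDefs.

Definition is_hom (G H : groupType) (f : G -> H) : Prop :=
  forall x y, f (x * y)%g = (f x * f y)%g.

Definition is_free_on (S : Type) (F : groupType) (iota : S -> F) : Prop :=
  forall (H : groupType) (f : S -> H),
    exists! phi : F -> H, is_hom phi /\ forall s, phi (iota s) = f s.

(* G admits a presentation (F | R) with R <= gamma_q(F):
   a free group F and a surjective homomorphism pi : F -> G (so G = F/R
   with R = ker pi) whose kernel is contained in gamma_q(F). *)
Definition has_presentation_in_gamma (G : groupType) (q : nat) : Prop :=
  exists (S : Type) (F : groupType) (iota : S -> F) (pi : F -> G),
    is_free_on iota /\ is_hom pi /\ (forall y, exists x, pi x = y) /\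
    (forall x, pi x = 1%g -> gamma q x).

Definition Zl (l : nat) := {ffun 'I_l -> int}.
Definition norm1 (l : nat) (m : Zl l) : RR := (\sum_i `|m i|)%:~R.
Definition dZ (l : nat) (m m' : Zl l) : RR := norm1 (m - m').

Definition dbounded (X : Type) (d : X -> X -> RR) (A : X -> Prop) : Prop :=
  exists C : RR, forall a b, A a -> A b -> d a b <= C.

Definition controlled_on (X Y : Type) (A : X -> Prop) (dX : X -> X -> RR)
  (dY : Y -> Y -> RR) (f : X -> Y) : Prop :=
  forall S : RR, exists T : RR, forall x x', A x -> A x' ->
    dX x x' <= S -> dY (f x) (f x') <= T.

Definition qi_embedding_on (X Y : Type) (A : X -> Prop) (dX : X -> X -> RR)
  (dY : Y -> Y -> RR) (f : X -> Y) : Prop :=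
  exists C1 C2 D1 D2 : RR, 0 < C1 /\ 0 < C2 /\ 0 <= D1 /\ 0 <= D2 /\
    forall x x', A x -> A x' ->
      C1 * dX x x' - D1 <= dY (f x) (f x') /\ dY (f x) (f x') <= C2 * dX x x' + D2.

(* Main.v *)
Require Import Defs.
From HB Require Import structures.
From mathcomp Require Import all_boot all_order all_algebra.
From mathcomp Require Import all_classical all_reals all_analysis.
From mathcomp Require Import Rstruct Rstruct_topology.
From mathcomp Require Import ring lra.
Import Order.TTheory GRing.Theory Num.Theory.
Import numFieldNormedType.Exports.
Local Open Scope ring_scope.
Set Implicit Arguments.
Unset Strict Implicit.
Unset Printing Implicit Defensive.

(* Both hypotheses give [G,L] <= N.
   For nu in Q(N)^G the function (g,x) |-> nu([g,x]) on G x L is, up to a bounded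
   error, bilinear; let b_nu be the bilinear form. Sum b_nu along the formal
   products of commutators [g_i,x_i] (x_i in L) whose value lies in [G,N], the
   "relations". These sums vanish for nu in H^1(N)^G and for nu extending to L.
   Conversely, if they vanish then |nu| is at most linear in the number of
   (G,L)-commutators on [G,N], and a Hahn-Banach argument on the group of
   sequences in L extends nu from [G,N] to Q(L)^G, so that nu is zero in W(G,L,N).
   Hence there are l relations s_j dual to a basis nu_i of W(G,L,N). Psi(m)
   evaluates the relations s_j with each g replaced by g^(k m_j), and Phi rounds
   the values nu_i / k for a large integer k. The same Hahn-Banach argument with
   L = N gives Bavard duality, by which all estimates for scl_{G,N} reduce to
   estimates of quasimorphisms. *)

(** * Commutator lengths *)

(** Hahn-Banach yields homomorphisms, whereas [(x * y) ^+ n] and [x ^+ n * y ^+ n] differ by up to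
    [n] commutators. For sequences such a discrepancy merely has finite growth rate, so a
    homomorphism dominated by the growth rate of commutator length restricts, on power sequences, to
    a quasimorphism. Growth rates can be infinite and the sequence group is not abelian; this is why
    graphs and epigraphs replace functions and subspaces. Scaling only the first entries keeps the
    number of commutators in a word independent of m. That one fact bounds the image of Psi for
    scl_{G,L} and makes the error in nu_i(Psi(m)) = k m_i + O(1) uniform in m, so that rounding
    recovers m exactly once k exceeds twice the error. For the lower bounds, an arbitrary
    quasimorphism is tested on the dual relations: after the corresponding multiples of the nu_i are
    subtracted, the rest is at most a multiple of scl_{G,L}. On sets bounded for scl_{G,L}, the
    finitely many nu_i therefore control scl_{G,N}. *)

Lemma archi_nat (R : realType) (x : R) : exists n : nat, (0 < n)%N /\ x <= n%:R.
Proof.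
exists (Num.truncn `|x|).+1; split=> //.
by rewrite (le_trans (ler_norm x))// ltW// truncnS_gt.
Qed.

Lemma cut_between (A B : RR -> Prop) :
  (exists x, A x) -> (exists y, B y) -> (forall x y, A x -> B y -> x <= y) ->
  exists t, (forall x, A x -> x <= t) /\ (forall y, B y -> t <= y).
Proof.
move=> [x0 Ax0] [y0 By0] AB; exists (sup A); split=> [x Ax|y By].
  by apply: ub_le_sup => //; exists y0 => z Az; apply: AB.
by apply: ge_sup; [exists x0 | move=> z Az; apply: AB].
Qed.

(** Identities known up to a uniform error become exact when both sides scale with [n]; bilinearity
    and additivity are obtained this way below. *)
Lemma multiples_bounded_eq0 (a C : RR) :
  (forall n : nat, `|n%:R * a| <= C) -> a = 0.
Proof.
move=> h; apply/eqP; rewrite -normr_eq0 eq_le normr_ge0 andbT.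
rewrite leNgt; apply/negP => a0.
have [n [n0 hn]] := archi_nat ((C + 1) / `|a|).
have := h n; rewrite normrM normr_nat.
by move: hn; rewrite ler_pdivrMr// => hn; lra.
Qed.

Lemma multiples_le (r s C : RR) :
  (forall n : nat, n%:R * r <= n%:R * s + C) -> r <= s.
Proof.
move=> h; rewrite leNgt; apply/negP => sr.
have d0 : 0 < r - s by rewrite subr_gt0.
have [n [n0 hn]] := archi_nat ((C + 1) / (r - s)).
by move: hn; rewrite ler_pdivrMr// mulrBr; have := h n; lra.
Qed.

Local Open Scope classical_set_scope.

Lemma subadditive_mul (R : realType) (a : nat -> R) (m n : nat) :
  (forall m n, a (m + n)%N <= a m + a n) -> a (m * n)%N <= m%:R * a n + a 0%N.
Proof.
move=> ha; elim: m => [|m IH]; first by rewrite mul0r add0r mul0n.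
by rewrite mulSn; apply: le_trans (ha _ _) _; rewrite -natr1 mulrDl mul1r; lra.
Qed.

(* Fekete's lemma *)
Lemma subadditive_limn (R : realType) (a : nat -> R) :
  (forall n, 0 <= a n) -> (forall m n, a (m + n)%N <= a m + a n) ->
  exists s : R, [/\ limn (fun n => a n / n%:R) = s,
    forall n, n%:R * s <= a n &
    forall e, 0 < e -> exists n, (0 < n)%N /\ a n <= n%:R * (s + e)].
Proof.
(* The index is shifted because [a 0 / 0] is 0 and would force the infimum down to 0. *)
move=> a0 ha; pose A := [set a n.+1 / n.+1%:R | n in [set: nat]].
have An n : A (a n.+1 / n.+1%:R) by exists n.
have hA : has_inf A.
  split; first by exists (a 1%N / 1%:R); apply: An.
  by exists 0 => _ [n _ <-]; rewrite divr_ge0.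
have le_s n : n%:R * inf A <= a n.
  case: n => [|n]; first by rewrite mul0r.
  rewrite mulrC -ler_pdivlMr//; apply: ge_inf (An n).
  by case: hA.
have lt_s e : 0 < e -> exists n, (0 < n)%N /\ a n <= n%:R * (inf A + e).
  move=> e0; have [_ [n _ <-] hn] := inf_adherent e0 hA.
  by exists n.+1; split=> //; rewrite mulrC -ler_pdivrMr// ltW.
exists (inf A); split=> //.
apply: cvg_lim => //; apply/cvgrPdist_le => e e0.
have e20 : 0 < e / 2 by rewrite divr_gt0.
have [m [m0 hm]] := lt_s _ e20.
have rem_le k : (k < m)%N -> a k <= m%:R * a 1%N + a 0%N.
  move=> km; have := @subadditive_mul R a k 1%N ha; rewrite muln1.
  move/le_trans; apply; rewrite lerD2r ler_wpM2r// ler_nat; exact: ltnW.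
pose K := m%:R * a 1%N + a 0%N + a 0%N.
have K0 : 0 <= K by rewrite !addr_ge0// mulr_ge0.
have [n0 [n00 hn0]] := archi_nat (K / (e / 2)).
exists n0 => // n /= n0n.
have n0' : (0 < n)%N by apply: leq_trans n0n.
have nR : 0 < n%:R :> R by rewrite ltr0n.
rewrite distrC ger0_norm; last by rewrite subr_ge0 ler_pdivlMr// mulrC.
rewrite lerBlDr ler_pdivrMr//.
have h1 : a n <= (n %/ m)%N%:R * a m + K.
  rewrite {1}(divn_eq n m); apply: le_trans (ha _ _) _.
  have := subadditive_mul (n %/ m)%N m ha; have := rem_le (n %% m)%N (ltn_pmod _ m0).
  by rewrite /K; lra.
have h2 : (n %/ m)%N%:R * a m <= n%:R * (inf A + e / 2).
  apply: le_trans (ler_wpM2l _ hm) _ => //; rewrite mulrA -natrM.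
  rewrite ler_wpM2r ?ler_nat ?leq_divM//.
  have := le_s 1%N; have := le_s m; have mR : 0 < m%:R :> R by rewrite ltr0n.
  move=> l1 _; have := a0 m; move: hm => /[swap] /le_trans /[apply].
  by rewrite pmulr_rge0.
have h3 : K <= n%:R * (e / 2).
  rewrite -ler_pdivrMr//; apply: le_trans hn0 _; by rewrite ler_nat.
rewrite mulrC; move: h1 h2 h3; rewrite !mulrDr; lra.
Qed.

Local Close Scope classical_set_scope.

(** Words are associated to the left and cancelled, so that identities of free groups close by
    reflexivity. *)
Ltac group_words :=
  rewrite /comm ?(mulgA, invgM, invgK, mulgK, mulgVK, mulVg, mulgV, mul1g, mulg1, invg1).

Section Commutators.
Variable G : groupType.
Implicit Types (x y g h c : G) (N : G -> Prop) (s : seq (G * G)).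
Local Open Scope group_scope.

(** The usual form [comm x g] of the inverse puts the entry from the normal subgroup first; this one
    keeps it second, as [cl] demands. *)
Lemma comm_inv g x : (comm g x)^-1 = comm g^-1 (g * x * g^-1).
Proof. by group_words. Qed.

Lemma comm_conj c g x :
  c * comm g x * c^-1 = comm (c * g * c^-1) (c * x * c^-1).
Proof. by group_words. Qed.

Lemma comm_1l x : comm 1 x = 1.
Proof. by group_words. Qed.

Lemma comm_mull g h x : comm (g * h) x = g * comm h x * g^-1 * comm g x.
Proof. by group_words. Qed.

Lemma comm_mulr g x y : comm g (x * y) = comm g x * (x * comm g y * x^-1).
Proof. by group_words. Qed.

Lemma conj_exp g x n : g * x ^+ n * g^-1 = (g * x * g^-1) ^+ n.
Proof.
elim: n => [|n IH]; first by rewrite !expg0 mulg1 mulgV.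
by rewrite !expgS -IH; group_words.
Qed.

Lemma subgroup_exp N x n : is_subgroup N -> N x -> N (x ^+ n).
Proof.
move=> [N1 [NM _]] Nx; elim: n => [|n IH] //.
by rewrite expgS; apply: NM.
Qed.

(** For [y] in [G,N] this is the witness form of [cl N y <= k], since trivial commutators can pad a
    product; it avoids the real infimum. *)
Definition prodn N k y : Prop :=
  exists s, [/\ size s = k, forall p, p \in s -> N p.2 & prod_comm s = y].

Lemma prod_comm_cat s1 s2 :
  prod_comm (s1 ++ s2) = prod_comm s1 * prod_comm s2.
Proof. by elim: s1 => [|p s IH] /=; rewrite ?mul1g// IH mulgA. Qed.

Lemma prodn1 N : prodn N 0 1.
Proof. by exists [::]; split. Qed.

Lemma prodn_comm N g x : N x -> prodn N 1 (comm g x).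
Proof.
move=> Nx; exists [:: (g, x)]; split=> //=; last by rewrite mulg1.
by move=> p; rewrite inE => /eqP ->.
Qed.

Lemma prodnM N k m x y : prodn N k x -> prodn N m y -> prodn N (k + m) (x * y).
Proof.
move=> [s [<- hs <-]] [t [<- ht <-]]; exists (s ++ t); split.
- by rewrite size_cat.
- by move=> p; rewrite mem_cat => /orP[/hs|/ht].
- by rewrite prod_comm_cat.
Qed.

Lemma prodn_ind N (Q : nat -> G -> Prop) :
  Q 0%N 1 -> (forall g x k y, N x -> prodn N k y -> Q k y -> Q k.+1 (comm g x * y)) ->
  forall k y, prodn N k y -> Q k y.
Proof.
move=> Q0 QS k y [s [<- hs <-]]; elim: s hs => [|[g x] s IH] hs //=.
have hs' p : p \in s -> N p.2 by move=> ps; apply: hs; rewrite inE ps orbT.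
apply: QS; first by apply: (hs (g, x)); rewrite inE eqxx.
- by exists s; split.
- exact: IH.
Qed.

Lemma prodn_conj N k c y : is_normal N -> prodn N k y -> prodn N k (c * y * c^-1).
Proof.
move=> [_ NJ]; move: k y; apply: prodn_ind => [|g x k y Nx _ IH].
  by rewrite mulg1 mulgV; apply: prodn1.
have -> : c * (comm g x * y) * c^-1 = (c * comm g x * c^-1) * (c * y * c^-1).
  by group_words.
by rewrite comm_conj -add1n; apply: prodnM IH; apply: prodn_comm; apply: NJ.
Qed.

Lemma prodnV N k y : is_normal N -> prodn N k y -> prodn N k y^-1.
Proof.
move=> [_ NJ]; move: k y; apply: prodn_ind => [|g x k y Nx _ IH].
  by rewrite invg1; apply: prodn1.
rewrite invgM comm_inv -addn1; apply: prodnM IH _; apply: prodn_comm; exact: NJ.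
Qed.

Lemma commGNP N y : is_normal N -> commGN N y <-> exists k, prodn N k y.
Proof.
move=> nN; split=> [|[k]].
  elim=> [_ [g [x [Nx ->]]]||x1 y1 _ [k hk] _ [m hm]|x1 _ [k hk]].
  - by exists 1%N; apply: prodn_comm.
  - by exists 0%N; apply: prodn1.
  - by exists (k + m)%N; apply: prodnM.
  - by exists k; apply: prodnV.
move: k y; apply: prodn_ind => [|g x k y Nx _ IH]; first exact: gen_one.
by apply: gen_mul IH; apply: gen_in; exists g, x.
Qed.

Lemma commGN_normal N : is_normal N -> is_normal (commGN N).
Proof.
move=> nN; split; first split; first exact: gen_one.
  by split=> [x y|x]; [apply: gen_mul|apply: gen_inv].
move=> g x /(commGNP _ nN)[k hk]; apply/(commGNP _ nN); exists k.
exact: prodn_conj.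
Qed.

Lemma commGN_sub N N' y :
  (forall x, N x -> N' x) -> commGN N y -> commGN N' y.
Proof.
move=> NN'; elim=> [_ [g [x [Nx ->]]]||x1 y1 _ h1 _ h2|x1 _ h1].
- by apply: gen_in; exists g, x; split=> //; apply: NN'.
- exact: gen_one.
- exact: gen_mul.
- exact: gen_inv.
Qed.

Lemma commGN_subN N y : is_normal N -> commGN N y -> N y.
Proof.
move=> [[N1 [NM NV]] NJ]; elim=> [_ [g [x [Nx ->]]]||x1 y1 _ h1 _ h2|x1 _ h1] //.
- by rewrite /comm; apply: NM; [apply: NJ | apply: NV].
- exact: NM.
- exact: NV.
Qed.

Local Open Scope ring_scope.

Lemma cl_le N k y : prodn N k y -> cl N y <= k%:R.
Proof.
move=> [s [sk hs sy]]; rewrite /cl; apply: ge_inf.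
  by exists 0 => _ [n _ <-]; rewrite ler0n.
by exists k => //=; exists s.
Qed.

Lemma cl_attained N y : is_normal N -> commGN N y ->
  exists k, prodn N k y /\ cl N y = k%:R.
Proof.
move=> nN /(commGNP _ nN) hy.
have hex : exists k, `[< prodn N k y >] by case: hy => k ?; exists k; apply/asboolP.
case: (ex_minnP hex) => k /asboolP hk kmin; exists k; split=> //.
apply/eqP; rewrite eq_le cl_le//= /cl; apply: lb_le_inf.
  by case: hk => s [sk hs sy]; exists k%:R, k => //=; exists s.
move=> _ [n [s [sn [hs sy]]] <-]; rewrite ler_nat; apply: kmin.
by apply/asboolP; exists s.
Qed.

(** Fekete's lemma makes [scl] an infimum of quotients m / n; from here on only these two halves are
    used, never the limit. *)
Lemma sclP N y : is_normal N -> commGN N y ->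
  (forall n m, prodn N m (y ^+ n)%g -> n%:R * scl N y <= m%:R) /\
  (forall e, 0 < e -> exists n m, [/\ (0 < n)%N, prodn N m (y ^+ n)%g &
     m%:R <= n%:R * (scl N y + e)]).
Proof.
move=> nN hy; have hyn n : commGN N (y ^+ n)%g.
  by apply: subgroup_exp hy; case: (commGN_normal nN).
have [|m n|s [cvs le_s lt_s]] := @subadditive_limn RR (fun n => cl N (y ^+ n)%g).
- by move=> n; have [k [_ ->]] := cl_attained nN (hyn n).
- have [k [hk ->]] := cl_attained nN (hyn m).
  have [k' [hk' ->]] := cl_attained nN (hyn n).
  by rewrite -natrD expgnDr; apply: cl_le; apply: prodnM.
have -> : scl N y = s by [].
split=> [n m hm|e /lt_s [n [n0 hn]]].
  exact: le_trans (le_s n) (cl_le hm).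
by have [k [hk ek]] := cl_attained nN (hyn n); exists n, k; rewrite -ek.
Qed.

Lemma scl_le_prodn N y k : is_normal N -> prodn N k y -> scl N y <= k%:R.
Proof.
move=> nN hk; have hy : commGN N y by apply/(commGNP _ nN); exists k.
by have := (sclP nN hy).1 1%N k hk; rewrite mul1r.
Qed.

Lemma scl_ge0 N y : is_normal N -> commGN N y -> 0 <= scl N y.
Proof.
move=> nN hy; rewrite leNgt; apply/negP => s0.
have e0 : 0 < - scl N y by rewrite oppr_gt0.
have e20 : 0 < - scl N y / 2 by rewrite divr_gt0.
have [n [m [n0 _]]] := (sclP nN hy).2 _ e20.
apply/negP; rewrite -ltNge; apply: (@lt_le_trans _ _ 0) => //.
by rewrite pmulr_rlt0 ?ltr0n//; lra.
Qed.

Lemma le_scl N y a K : is_normal N -> commGN N y -> 0 <= K ->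
  (forall n m, prodn N m (y ^+ n)%g -> n%:R * a <= m%:R * K) -> a <= K * scl N y.
Proof.
move=> nN hy K0 h; apply/ler_addgt0Pr => e e0.
(* Dividing by [K + 1] instead of [K] covers [K = 0]. *)
have f0 : 0 < e / (K + 1) by rewrite divr_gt0//; lra.
have [n [m [n0 hm hle]]] := (sclP nN hy).2 _ f0.
have nR : 0 < n%:R :> RR by rewrite ltr0n.
rewrite -(ler_pM2l nR); apply: le_trans (h _ _ hm) _.
have h2 : m%:R * K <= n%:R * (scl N y + e / (K + 1)) * K by rewrite ler_wpM2r.
have h3 : K * (e / (K + 1)) <= e.
  by rewrite mulrA ler_pdivrMr; [nra|lra].
have h4 : n%:R * (K * (e / (K + 1))) <= n%:R * e by rewrite ler_pM2l.
by move: h2 h4; move: (e / _) => f; rewrite !mulrDr; lra.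
Qed.

Lemma scl_inv N y : is_normal N -> commGN N y -> scl N y^-1%g <= scl N y.
Proof.
move=> nN hy; apply/ler_addgt0Pr => e e0.
have [n [m [n0 hm hle]]] := (sclP nN hy).2 _ e0.
have hy' : commGN N (y^-1)%g by apply: gen_inv.
have := (sclP nN hy').1 n m; rewrite expVgn => /(_ (prodnV nN hm)) h.
have := le_trans h hle; by rewrite ler_pM2l // ltr0n.
Qed.

End Commutators.

(** * The Hahn-Banach theorem for graphs in a group *)

Section IntegerPowers.
Variable G : groupType.
Implicit Types (x : G) (k m : int).
Local Open Scope group_scope.

Lemma zpowN x (n : nat) : zpow x (- n%:Z)%R = (x ^+ n)^-1.
Proof. by case: n => [|n] //; rewrite ?oppr0 /= ?invg1// -NegzE. Qed.

Lemma zpowS x k : zpow x (k + 1)%R = zpow x k * x.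
Proof.
case: k => n; first by rewrite -PoszD addn1 /= expgSr.
rewrite NegzE; have -> : (- n.+1%:Z + 1 = - n%:Z)%R.
  by rewrite -addn1 PoszD opprD -addrA addNr addr0.
by rewrite !zpowN expgS; group_words.
Qed.

Lemma zpowB1 x k : zpow x (k - 1)%R = zpow x k * x^-1.
Proof. by rewrite -{2}(subrK 1%R k) zpowS mulgK. Qed.

Lemma zpowD x k m : zpow x (k + m)%R = zpow x k * zpow x m.
Proof.
elim/int_ind: m => [|n IH|n IH]; first by rewrite addr0 /= mulg1.
  by rewrite -addn1 PoszD addrA !zpowS IH mulgA.
by rewrite -addn1 PoszD opprD addrA !zpowB1 IH mulgA.
Qed.

Lemma zpowV x k : zpow x (- k)%R = (zpow x k)^-1.
Proof. by apply/esym/mulg1_eq; rewrite -zpowD subrr. Qed.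

Lemma subgroup_zpow N x k : is_subgroup N -> N x -> N (zpow x k).
Proof.
move=> sN Nx; have [_ [_ NV]] := sN.
by case: k => n /=; [|apply: NV]; apply: subgroup_exp.
Qed.

End IntegerPowers.

Section HahnBanach.
Variables (T : groupType) (M : T -> Prop) (P : T -> RR -> Prop).
Hypothesis sM : is_subgroup M.
Hypothesis P1 : P 1%g 0.
Hypothesis PM : forall a b r s, P a r -> P b s -> P (a * b)%g (r + s).
Hypothesis PV : forall a r, P a r -> P a^-1%g r.

(* [S] is the graph of a partial homomorphism which is dominated by the
   sublinear function whose epigraph is [P]; being single-valued is a
   consequence of the domination at 1. *)
Record dominated_graph (S : T -> RR -> Prop) : Prop := DominatedGraph {
  graph_dom : forall a r, S a r -> M a;
  graphM : forall a b r s, S a r -> S b s -> S (a * b)%g (r + s);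
  graphV : forall a r, S a r -> S a^-1%g (- r);
  graph_comm : forall a b, M a -> M b -> S (comm a b) 0;
  graph_le : forall a r s, S a r -> P a s -> r <= s }.

Section Extension.
Variables (S : T -> RR -> Prop) (v : T).
Hypotheses (dS : dominated_graph S) (Mv : M v).

Lemma graph1 : S 1%g 0.
Proof.
by have [M1 _] := sM; have := graph_comm dS M1 M1; rewrite comm_1l.
Qed.

Lemma graph_conj g a r : M g -> S a r -> S (g * a * g^-1)%g r.
Proof.
move=> Mg Sa; have -> : (g * a * g^-1 = comm g a * a)%g by group_words.
rewrite -[r]add0r; apply: (graphM dS _ Sa).
by apply: graph_comm => //; apply: (graph_dom dS Sa).
Qed.

(** Commutators carry the value 0, so conjugation preserves values, and all copies of [b] can be
    collected to the left of the powers of [w]. This replaces commutativity in the extension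
    step. *)
Lemma graphMX w b u n : M w -> S b u ->
  exists b', S b' (n%:R * u) /\ ((b * w) ^+ n = b' * w ^+ n)%g.
Proof.
move=> Mw Sb; elim: n => [|n [b' [Sb' e]]].
  by exists 1%g; rewrite mul0r mulg1; split=> //; apply: graph1.
exists (b * (w * b' * w^-1))%g; split.
  by rewrite -natr1 mulrDl mul1r addrC; apply: graphM => //; apply: graph_conj.
by rewrite !expgS e; group_words.
Qed.

Lemma epigraphX a r n : P a r -> P (a ^+ n)%g (n%:R * r).
Proof.
move=> Pa; elim: n => [|n IH]; first by rewrite mul0r.
by rewrite expgS -natr1 mulrDl mul1r addrC; apply: PM.
Qed.

(** As in the classical one-step extension, negative powers of [v] bound the new value [t] from
    below (the set [A]) and positive powers bound it from above ([B]). *)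
Lemma extension_value : exists t : RR, forall b u k s,
  S b u -> P (b * zpow v k)%g s -> u + k%:~R * t <= s.
Proof.
pose A x := exists b u n s, [/\ S b u, P (b * (v ^+ n.+1)^-1)%g s &
  x = (u - s) / n.+1%:R].
pose B y := exists b u n s, [/\ S b u, P (b * v ^+ n.+1)%g s &
  y = (s - u) / n.+1%:R].
have [_ [MM MV]] := sM.
have Mvn n : M (v ^+ n)%g by apply: subgroup_exp.
(* Costs may be infinite, so [A] and [B] may be empty, but only together: [P] is closed under
   inversion, which exchanges the two kinds of constraint after a conjugation. *)
have AB : (exists x, A x) -> (exists y, B y).
  move=> [_ [b [u [n [s [Sb Pb _]]]]]]; eexists.
  exists (v ^+ n.+1 * b^-1 * (v ^+ n.+1)^-1)%g, (- u), n, s; split; last by [].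
    by apply: graph_conj => //; apply: graphV.
  by move/PV: Pb; group_words.
have BA : (exists y, B y) -> (exists x, A x).
  move=> [_ [b [u [n [s [Sb Pb _]]]]]]; eexists.
  exists ((v ^+ n.+1)^-1 * b^-1 * (v ^+ n.+1)^-1^-1)%g, (- u), n, s; split; last by [].
    by apply: graph_conj; [apply: MV|apply: graphV].
  by move/PV: Pb; group_words.
have leAB x y : A x -> B y -> x <= y.
  move=> [b [u [n [s [Sb Pb ->]]]]] [c [u' [m [s' [Sc Pc ->]]]]].
  have MVn := MV _ (Mvn n.+1).
  (* Crossing the exponents makes the two powers of [v] inverse to each other; they cancel in the
     product, and the domination of [S] applies. *)
  have [b' [Sb' eb]] := graphMX m.+1 MVn Sb.
  have [c' [Sc' ec]] := graphMX n.+1 (Mvn m.+1) Sc.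
  have := PM (epigraphX m.+1 Pb) (epigraphX n.+1 Pc); rewrite eb ec.
  rewrite expVgn -!expgnA (mulnC m.+1); set V := (v ^+ _)%g.
  have -> : (b' * V^-1 * (c' * V) = b' * (V^-1 * c' * V^-1^-1))%g by group_words.
  have MVV : M V^-1%g by apply: MV; apply: Mvn.
  have /(graph_le dS) := graphM dS Sb' (graph_conj MVV Sc') => /[apply] h.
  rewrite ler_pdivrMr// mulrAC ler_pdivlMr//; lra.
have [t [tA tB]] : exists t, (forall x, A x -> x <= t) /\ (forall y, B y -> t <= y).
  have [exA|nA] := pselect (exists x, A x).
    by apply: cut_between => //; apply: AB.
  exists 0; split=> [x Ax|y By]; exfalso; first by apply: nA; exists x.
  by apply: nA; apply: BA; exists y.
exists t => b u [[|n]|n] s Sb Pb.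
- by rewrite mul0r addr0; apply: (graph_le dS Sb); move: Pb; rewrite mulg1.
- have : B ((s - u) / n.+1%:R) by exists b, u, n, s.
  by move/tB; rewrite ler_pdivlMr// mulrC -pmulrn; lra.
- have : A ((u - s) / n.+1%:R) by exists b, u, n, s.
  by move/tA; rewrite ler_pdivrMr// mulrC NegzE mulrNz -pmulrn; lra.
Qed.

Lemma graph_extension : exists S', [/\ dominated_graph S',
  forall a r, S a r -> S' a r & exists r, S' v r].
Proof.
have [t ht] := extension_value; have [_ [MM MV]] := sM.
have Mz k : M (zpow v k) by apply: subgroup_zpow.
pose S' a r := exists b u k, [/\ S b u, a = (b * zpow v k)%g & r = u + k%:~R * t].
exists S'; split=> [|a r Sa|].
- split.
  + by move=> _ _ [b [u [k [Sb -> _]]]]; apply: MM => //; apply: graph_dom Sb.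
  + move=> _ _ _ _ [b [u [k [Sb -> ->]]]] [c [w [j [Sc -> ->]]]].
    exists (b * (zpow v k * c * (zpow v k)^-1))%g, (u + w), (k + j); split.
    * by apply: graphM => //; apply: graph_conj.
    * by rewrite zpowD; group_words.
    * by rewrite intrD; ring.
  + move=> _ _ [b [u [k [Sb -> ->]]]].
    exists ((zpow v k)^-1 * b^-1 * (zpow v k)^-1^-1)%g, (- u), (- k); split.
    * by apply: graph_conj; [apply: MV|apply: graphV].
    * by rewrite zpowV; group_words.
    * by rewrite mulrNz; ring.
  + move=> a b Ma Mb; exists (comm a b), 0, 0; split; first exact: graph_comm.
      by rewrite mulg1.
    by rewrite mul0r addr0.
  + by move=> _ _ s [b [u [k [Sb -> ->]]]]; apply: ht.
- by exists a, r, 0; rewrite mul0r addr0 mulg1.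
- exists (0 + 1%:~R * t), 1%g, 0, 1; split=> //; first exact: graph1.
  by rewrite mul1g.
Qed.

End Extension.

Lemma hahn_banach (S0 : T -> RR -> Prop) : dominated_graph S0 ->
  exists S, [/\ dominated_graph S, forall a r, S0 a r -> S a r &
    forall a, M a -> exists r, S a r].
Proof.
(* Adding [S0] to every set makes the empty chain harmless: its union still stands for [S0]. *)
move=> d0; pose U (X : set (T * RR)) a r := S0 a r \/ X (a, r).
have [F FQ Ftot|X [dX Xmax]] := @Zorn_bigcup _ (fun X => dominated_graph (U X)).
  have common X Y : F X -> F Y -> exists Z, [/\ F Z,
      forall p, X p -> Z p & forall p, Y p -> Z p].
    by move=> FX FY; have [XY|YX] := Ftot _ _ FX FY; [exists Y|exists X]; split.
  pose W := U (\bigcup_(X in F) X)%classic.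
  have WE a r : W a r -> S0 a r \/ exists X, F X /\ U X a r.
    by move=> [?|[X FX Xa]]; [left|right; exists X; split=> //; right].
  have EW X a r : F X -> U X a r -> W a r.
    by move=> FX [?|Xa]; [left|right; exists X].
  split.
  - move=> a r /WE[Sa|[X [FX Xa]]]; first exact: (graph_dom d0 Sa).
    exact: (graph_dom (FQ _ FX) Xa).
  - move=> a b r s /WE[Sa|[X [FX Xa]]] /WE[Sb|[Y [FY Yb]]].
    + by left; apply: (graphM d0).
    + by apply: (EW Y) => //; apply: (graphM (FQ _ FY)) => //; left.
    + by apply: (EW X) => //; apply: (graphM (FQ _ FX)) => //; left.
    + have [Z [FZ XZ YZ]] := common _ _ FX FY; apply: (EW Z) => //.
      apply: (graphM (FQ _ FZ)).
        by case: Xa => [?|/XZ]; [left|right].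
      by case: Yb => [?|/YZ]; [left|right].
  - move=> a r /WE[Sa|[X [FX Xa]]]; first by left; apply: (graphV d0).
    by apply: (EW X) => //; apply: (graphV (FQ _ FX)).
  - by move=> a b Ma Mb; left; apply: (graph_comm d0).
  - move=> a r s /WE[Sa|[X [FX Xa]]]; first exact: (graph_le d0 Sa).
    exact: (graph_le (FQ _ FX) Xa).
exists (U X); split=> // [a r ?|v Mv]; first by left.
have [S' [dS' XS' [r S'v]]] := graph_extension dX Mv.
have [XSv|nX] := pselect (exists r, U X v r) => //; exfalso.
pose Y : set (T * RR) := fun p => S' p.1 p.2.
have US' : U Y = S'.
  apply/funext => a; apply/funext => u; apply/propext; split=> [[S0a|]|] //.
    by apply: XS'; left.
  by right.
apply: (Xmax Y); last by rewrite US'.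
split=> [|YX]; first by move=> [a u] Xa; apply: XS'; right.
by apply: nX; exists r; right; apply: YX.
Qed.

Lemma graph_functional S a r s : dominated_graph S -> S a r -> S a s -> r = s.
Proof.
move=> dS.
suff h u w : S a u -> S a w -> u <= w by move=> Sr Ss; apply/eqP; rewrite eq_le !h.
move=> Su Sw; have := graphM dS Su (graphV dS Sw); rewrite mulgV => S1.
by have := graph_le dS S1 P1; lra.
Qed.

Lemma dominated_hom (S0 : T -> RR -> Prop) : dominated_graph S0 ->
  exists f : T -> RR, [/\ forall a b, M a -> M b -> f (a * b)%g = f a + f b,
    forall a r, M a -> P a r -> f a <= r & forall a r, S0 a r -> f a = r].
Proof.
move=> /hahn_banach[S [dS S0S tot]].
have /choice[f hf] : forall a, exists r, M a -> S a r.
  move=> a; have [Ma|nMa] := pselect (M a); last by exists 0 => /nMa.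
  by have [r Sr] := tot a Ma; exists r.
have [_ [MM _]] := sM.
exists f; split=> [a b Ma Mb|a r Ma Pa|a r S0a].
- apply: (graph_functional dS (hf _ (MM _ _ Ma Mb))).
  by apply: (graphM dS); apply: hf.
- exact: (graph_le dS (hf _ Ma) Pa).
- have Sa := S0S _ _ S0a.
  exact: (graph_functional dS (hf _ (graph_dom dS Sa)) Sa).
Qed.

End HahnBanach.

(** * Quasimorphisms and Bavard duality *)

Section SequenceGroup.
Variable G : groupType.

Definition gseq := nat -> G.
HB.instance Definition _ := Choice.copy gseq (nat -> G).

Let mul (u v : gseq) : gseq := fun n => (u n * v n)%g.
Let one : gseq := fun=> 1%g.
Let inv (u : gseq) : gseq := fun n => (u n)^-1%g.
Let mulA : associative mul.
Proof. by move=> u v w; apply/funext => n; rewrite /mul mulgA. Qed.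
Let mul1 : left_id one mul.
Proof. by move=> u; apply/funext => n; rewrite /mul mul1g. Qed.
Let mulr1 : right_id one mul.
Proof. by move=> u; apply/funext => n; rewrite /mul mulg1. Qed.
Let mulV : left_inverse one inv mul.
Proof. by move=> u; apply/funext => n; rewrite /mul mulVg. Qed.
Let mulrV : right_inverse one inv mul.
Proof. by move=> u; apply/funext => n; rewrite /mul mulgV. Qed.
HB.instance Definition _ := isGroup.Build gseq mulA mul1 mulr1 mulV mulrV.

Lemma gseqX (u : gseq) k n : (u ^+ k)%g n = (u n ^+ k)%g.
Proof. by elim: k => [|k IH] //; rewrite !expgS -IH. Qed.

Definition powers (x : G) : gseq := fun n => (x ^+ n)%g.

Lemma powersX x k : powers (x ^+ k)%g = (powers x ^+ k)%g.
Proof. by apply/funext => n; rewrite gseqX /powers expgnAC. Qed.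

Lemma powersV x : powers x^-1%g = (powers x)^-1%g.
Proof. by apply/funext => n; rewrite /powers expVgn. Qed.

End SequenceGroup.

Section Quasimorphisms.
Variable G : groupType.
Implicit Types (x y z g : G) (M N L : G -> Prop) (nu mu : G -> RR).

Definition defect_le N nu (D : RR) : Prop := forall x y, N x -> N y ->
  `|nu (x * y)%g - nu x - nu y| <= D.

Lemma QG_X N nu x n : QG N nu -> N x -> nu (x ^+ n)%g = n%:R * nu x.
Proof. by move=> [h _] Nx; have := h x n%:Z Nx; rewrite /= pmulrn. Qed.

Lemma QG_1 N nu : is_normal N -> QG N nu -> nu 1%g = 0.
Proof. by move=> [[N1 _] _] q; rewrite -(expg0 1%g) (QG_X 0 q)// mul0r. Qed.

Lemma QG_V N nu x : QG N nu -> N x -> nu x^-1%g = - nu x.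
Proof.
by move=> [h _] Nx; have := h x (- 1) Nx; rewrite (zpowN x 1) => ->; rewrite mulN1r.
Qed.

Section Bounds.
Variables (N : G -> Prop) (nu : G -> RR) (D : RR).
Hypotheses (nN : is_normal N) (q : QG N nu) (dD : defect_le N nu D).

Lemma defect_ge0 : 0 <= D.
Proof.
have [[N1 _] _] := nN; apply: le_trans (dD N1 N1); exact: normr_ge0.
Qed.

Lemma QG_le_comm g x : N x -> `|nu (comm g x)| <= D.
Proof.
move=> Nx; have [[_ [_ NV]] NJ] := nN; have [_ [_ inv]] := q.
have := dD (NJ g x Nx) (NV _ Nx); rewrite (QG_V q)// inv//.
by rewrite /comm (_ : _ - _ - _ = nu (g * x * g^-1 * x^-1)%g)//; ring.
Qed.

(** The factor 2 pays [D] for the value on each commutator and [D] for multiplying it in. *)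
Lemma QG_le_prodn k y : prodn N k y -> `|nu y| <= 2 * k%:R * D.
Proof.
have D0 := defect_ge0.
move: k y; apply: prodn_ind => [|g x k y Nx hy IH].
  by rewrite (QG_1 nN q) normr0 mulr0 mul0r.
have Ny : N y by apply: (commGN_subN nN); apply/(commGNP _ nN); exists k.
have Nc : N (comm g x).
  by apply: (commGN_subN nN); apply/(commGNP _ nN); exists 1%N; apply: prodn_comm.
have := dD Nc Ny; have := QG_le_comm g Nx; move: IH.
by rewrite -natr1 !ler_norml => /andP[a1 a2] /andP[b1 b2] /andP[c1 c2]; lra.
Qed.

Lemma QG_le_scl y : commGN N y -> `|nu y| <= 2 * D * scl N y.
Proof.
move=> hy; apply: le_scl => //; first by rewrite mulr_ge0// defect_ge0.
move=> n m /QG_le_prodn; rewrite (QG_X n q); last exact: commGN_subN.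
by rewrite normrM normr_nat mulrA [m%:R * 2]mulrC.
Qed.

Lemma QG_divl x y : N x -> N y -> `|nu (x^-1 * y)%g - (nu y - nu x)| <= D.
Proof.
move=> Nx Ny; have [[_ [_ NV]] _] := nN.
have := dD (NV _ Nx) Ny; rewrite (QG_V q)//.
by rewrite (_ : _ - _ - nu y = nu (x^-1 * y)%g - (nu y - nu x))//; ring.
Qed.

End Bounds.

(** Passing from [n] to [n.+1] moves one [y] across [x ^+ n], which costs a single commutator with
    entry [x ^+ n] in [M]. *)
Lemma prodn_mulX M x y n : is_normal M -> M x ->
  prodn M n ((x * y) ^+ n * (x ^+ n * y ^+ n)^-1)%g.
Proof.
move=> nM Mx; elim: n => [|n IH]; first by rewrite !expg0 !mulg1 invg1 mulg1; apply: prodn1.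
have -> : ((x * y) ^+ n.+1 * (x ^+ n.+1 * y ^+ n.+1)^-1 =
   (x * y) * ((x * y) ^+ n * (x ^+ n * y ^+ n)^-1) * (x * y)^-1
   * (x * comm y (x ^+ n) * x^-1))%g.
  by rewrite (expgS (x * y)%g) (expgS x) (expgS y); group_words.
rewrite -addn1; apply: prodnM; apply: prodn_conj => //; apply: prodn_comm.
by apply: subgroup_exp => //; case: nM.
Qed.

Definition seq_in M : gseq G -> Prop := fun w => forall n, M (w n).

(** This is the epigraph of [c] times the growth rate of the commutator length of [w n]. The
    constant [C] makes it insensitive to factors of bounded length, and no [r] qualifies when the
    growth is faster than linear. *)
Definition seq_cost M (c : RR) (w : gseq G) (r : RR) : Prop :=
  exists C : RR, forall n, exists m, prodn M m (w n) /\ c * m%:R <= n%:R * r + C.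

Lemma seq_in_subgroup M : is_normal M -> is_subgroup (seq_in M).
Proof.
move=> [[M1 [MM MV]] _]; split=> [n|] //; split=> [u v Mu Mv n|u Mu n].
  exact: MM.
exact: MV.
Qed.

Lemma seq_cost1 M c : seq_cost M c 1%g 0.
Proof.
by exists 0 => n; exists 0%N; split; [apply: prodn1|rewrite !mulr0 addr0].
Qed.

Lemma seq_costM M c u v r s :
  seq_cost M c u r -> seq_cost M c v s -> seq_cost M c (u * v)%g (r + s).
Proof.
move=> [C hu] [C' hv]; exists (C + C') => n.
have [m [hm lm]] := hu n; have [k [hk lk]] := hv n.
exists (m + k)%N; split; first exact: prodnM.
by rewrite natrD !mulrDr; lra.
Qed.

Lemma seq_costV M c u r : is_normal M -> seq_cost M c u r -> seq_cost M c u^-1%g r.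
Proof.
move=> nM [C hu]; exists C => n; have [m [hm lm]] := hu n.
by exists m; split=> //; apply: prodnV.
Qed.

(* Evaluating the extended homomorphism on the sequences [n |-> x ^+ n] makes
   homogeneity and invariance exact and turns the growth rate [c] of the
   correction term of [prodn_mulX] into the defect. *)
Lemma QG_of_graph M c S0 : is_normal M -> 0 <= c ->
  dominated_graph (seq_in M) (seq_cost M c) S0 ->
  exists mu, [/\ QG M mu, defect_le M mu c &
    forall x r, S0 (powers x) r -> mu x = r].
Proof.
move=> nM c0 dS; have sM := seq_in_subgroup nM.
have [f [fM fle fS]] := dominated_hom sM (seq_cost1 M c) (@seq_costM M c)
  (fun a r => @seq_costV M c a r nM) dS.
have [u1 [uM uV]] := sM.
have f1 : f 1%g = 0 by have := fM _ _ u1 u1; rewrite mulg1; lra.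
have fV a : seq_in M a -> f a^-1%g = - f a.
  by move=> Ma; have := fM _ _ Ma (uV _ Ma); rewrite mulgV f1; lra.
have fX a k : seq_in M a -> f (a ^+ k)%g = k%:R * f a.
  move=> Ma; elim: k => [|k IH]; first by rewrite f1 mul0r.
  rewrite expgS fM//; last exact: (@subgroup_exp _ (seq_in M)).
  by rewrite IH -natr1; ring.
have fdiv a b r : seq_in M a -> seq_in M b -> seq_cost M c (a * b^-1)%g r ->
    `|f a - f b| <= r.
  move=> Ma Mb hab; rewrite ler_norml -fV// -fM//; last exact: uV.
  have Mab := uM _ _ Ma (uV _ Mb).
  rewrite (fle _ _ Mab hab) andbT lerNl -fV//; by apply: (fle _ _ _ (seq_costV nM hab)); apply: uV.
have [[M1 [MM MV]] MJ] := nM.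
have Mp x : M x -> seq_in M (powers x).
  by move=> Mx n; apply: subgroup_exp Mx; case: nM.
exists (fun x => f (powers x)); split; last by move=> x r /fS.
- split; [|split].
  + move=> x [k|k] Mx /=.
      by rewrite powersX fX; [rewrite pmulrn|apply: Mp].
    have MXk : M (x ^+ k.+1)%g by apply: subgroup_exp => //; case: nM.
    rewrite powersV fV ?powersX ?fX; try exact: Mp.
      by rewrite NegzE mulrNz -pmulrn mulNr.
    by rewrite -powersX; apply: Mp.
  + exists c => x y Mx My; rewrite -addrA -opprD -fM; try exact: Mp.
    apply: fdiv; [by apply/Mp/MM|by apply: uM; apply: Mp|].
    exists 0 => n; exists n; split; first exact: prodn_mulX.
    by rewrite addr0 mulrC.
  + move=> g x Mx; apply/eqP; rewrite -subr_eq0 -normr_le0.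
    apply: fdiv; [by apply/Mp/MJ|exact: Mp|].
    (* For every [n] the two sequences differ by one commutator: a constant cost of slope 0, hence
       exact invariance. *)
    exists c => n; exists 1%N; split; last by rewrite mulr1 mulr0 add0r.
    have -> : (powers (g * x * g^-1) * (powers x)^-1)%g n = comm g (x ^+ n)%g.
      by rewrite /comm conj_exp.
    by apply: prodn_comm; apply: Mp.
- move=> x y Mx My; rewrite -addrA -opprD -fM; try exact: Mp.
  apply: fdiv; [by apply/Mp/MM|by apply: uM; apply: Mp|].
  exists 0 => n; exists n; split; first exact: prodn_mulX.
  by rewrite addr0 mulrC.
Qed.

(* Sequences within bounded commutator length of [n |-> y ^ (j n)] are sent to
   [j * scl N y]. *)
Lemma bavard N y : is_normal N -> commGN N y ->
  exists nu, [/\ QG N nu, defect_le N nu 1 & nu y = scl N y].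
Proof.
move=> nN hy; have s0 := scl_ge0 nN hy; set s := scl N y.
have Ny := commGN_subN nN hy; have [[N1 [NM NV]] NJ] := nN.
have Nyj n j : N (zpow (y ^+ n)%g j).
  by apply: subgroup_zpow => //; apply: subgroup_exp.
have prodN m x : prodn N m x -> N x.
  by move=> hx; apply: (commGN_subN nN); apply/(commGNP _ nN); exists m.
pose S0 (w : gseq G) (r : RR) := exists (j : int) K, r = j%:~R * s /\
  forall n, prodn N K (w n * (zpow (y ^+ n) j)^-1)%g.
have [|nu [q d e]] := @QG_of_graph N 1 S0 nN ler01; last first.
  exists nu; split=> //; apply: e; exists 1, 0%N; rewrite mul1r; split=> // n.
  by rewrite /powers /= mulgV; apply: prodn1.
split.
- move=> w _ [j [K [_ hw]]] n.
  rewrite -(mulgVK (zpow (y ^+ n)%g j) (w n)); apply: NM => //; exact: prodN (hw n).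
- move=> a b _ _ [j [K [-> ha]]] [k [K' [-> hb]]].
  exists (j + k), (K' + K)%N; split; first by rewrite intrD mulrDl.
  move=> n; rewrite zpowD (_ : (_ * _)%g =
    (a n * (b n * (zpow (y ^+ n) k)^-1) * (a n)^-1 * (a n * (zpow (y ^+ n) j)^-1))%g).
    by apply: prodnM => //; apply: prodn_conj.
  by rewrite (_ : (a * b)%g n = (a n * b n)%g)//; group_words.
- move=> a _ [j [K [-> ha]]]; exists (- j), K; split; first by rewrite mulrNz mulNr.
  move=> n; rewrite zpowV (_ : (_ * _)%g =
    ((a n)^-1 * (a n * (zpow (y ^+ n) j)^-1)^-1 * (a n)^-1^-1)%g).
    by apply: prodn_conj => //; apply: prodnV.
  by rewrite (_ : (a^-1)%g n = (a n)^-1%g)//; group_words.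
- move=> a b Na Nb; exists 0, 1%N; split=> [|n]; first by rewrite mul0r.
  by rewrite invg1 mulg1; apply: (prodn_comm (a n) (Nb n)).
- move=> a _ t [j [K [-> ha]]] [C hC].
  have t0 : 0 <= t.
    apply: (@multiples_le _ _ C) => n; have [m [_]] := hC n.
    by rewrite mulr0 mul1r; apply: le_trans.
  case: j ha => j ha; last first.
    apply: le_trans t0; rewrite NegzE mulrNz mulNr oppr_le0 -pmulrn mulr_ge0//.
  (* Here [y ^+ (n * j)] is a product of [K + m] commutators with [m <= n * t + C]; comparing with
     [n * j * s] for all [n] removes the constants. *)
  apply: (@multiples_le _ _ (K%:R + C)) => n; have [m [hm lm]] := hC n.
  have hyj : prodn N (K + m) (y ^+ (n * j))%g.
    have -> : (y ^+ (n * j) = (a n * (zpow (y ^+ n) j)^-1)^-1 * a n)%g.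
      by rewrite /= -expgnA; group_words.
    by apply: prodnM => //; apply: prodnV.
  have := (sclP nN hy).1 _ _ hyj; rewrite natrM natrD -pmulrn -/s.
  by move: lm; rewrite mul1r mulrA; lra.
Qed.

(** Together with [QG_le_scl] this determines [scl] up to a factor 2, which suffices for coarse
    statements. *)
Lemma scl_le_QG N z r : is_normal N -> commGN N z ->
  (forall nu, QG N nu -> defect_le N nu 1 -> `|nu z| <= r) -> scl N z <= r.
Proof.
move=> nN hz h; have [nu [q d <-]] := bavard nN hz.
exact: le_trans (ler_norm _) (h nu q d).
Qed.

(** Duality turns this triangle-type inequality into arithmetic with values of one quasimorphism.
    The factors 2 come from [QG_le_scl], the additive 2 from two uses of [QG_divl]. The base point
    [a] lets a diameter bound enter. *)
Lemma scl_divl N a x y : is_normal N -> commGN N a -> commGN N x -> commGN N y ->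
  scl N (x^-1 * y)%g <= 2 * scl N (a^-1 * x)%g + 2 * scl N a + 2 * scl N y + 2.
Proof.
move=> nN ha hx hy; have cN := commGN_subN nN.
have hV z w : commGN N z -> commGN N w -> commGN N (z^-1 * w)%g.
  by move=> hz hw; apply: gen_mul => //; apply: gen_inv.
apply: scl_le_QG => //; first exact: hV.
move=> nu q d; have := QG_divl nN q d (cN _ hx) (cN _ hy).
have := QG_divl nN q d (cN _ ha) (cN _ hx).
have := QG_le_scl nN q d hy; have := QG_le_scl nN q d ha.
have := QG_le_scl nN q d (hV _ _ ha hx).
rewrite !ler_norml mulr1.
move=> /andP[a1 a2] /andP[b1 b2] /andP[c1 c2] /andP[d1 d2] /andP[e1 e2].
by apply/andP; split; lra.
Qed.

(** The powers [(x * y) ^+ n] and [x ^+ n * y ^+ n] differ by an element of [G,N], where [h]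
    vanishes, so [n] times the failure of additivity stays bounded. *)
Lemma QG_vanishing_hom N h : is_normal N -> QG N h ->
  (forall z, commGN N z -> h z = 0) -> H1G N h.
Proof.
move=> nN q h0; have [_ [[D dD] inv]] := q; split=> // x y Nx Ny.
have [[N1 [NM NV]] NJ] := nN.
apply/eqP; rewrite -subr_eq0; apply/eqP/(@multiples_bounded_eq0 _ (D + D)) => n.
have NX z : N z -> N (z ^+ n)%g by move=> Nz; apply: subgroup_exp => //; case: nN.
pose w := ((x * y) ^+ n * (x ^+ n * y ^+ n)^-1)%g.
have hw : commGN N w by apply/(commGNP _ nN); exists n; apply: prodn_mulX.
have e : ((x * y) ^+ n = w * (x ^+ n * y ^+ n))%g by rewrite /w mulgVK.
have := dD _ _ (NX _ Nx) (NX _ Ny).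
have := dD _ _ (commGN_subN nN hw) (NM _ _ (NX _ Nx) (NX _ Ny)).
rewrite -e (h0 _ hw) !(QG_X n q)//; last exact: NM.
rewrite !ler_norml mulrDr !mulrN mulrDr => /andP[a1 a2] /andP[b1 b2].
by apply/andP; split; lra.
Qed.

(** The linear bound is precisely the domination needed for cost rate [D] on [L]. The extension
    agrees with [nu] on [G,N] only; the difference vanishes there and is thus a homomorphism on
    [N]. *)
Lemma QG_extends L N nu D : is_normal L -> is_normal N -> (forall x, N x -> L x) ->
  QG N nu -> 0 <= D ->
  (forall k z, commGN N z -> prodn L k z -> `|nu z| <= k%:R * D) ->
  exists h mu, [/\ H1G N h, QG L mu & forall x, N x -> nu x = h x + mu x].
Proof.
move=> nL nN NL q D0 hD; have [[L1 [LM LV]] LJ] := nL.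
have [_ [[E dE] inv]] := q; have [[N1 [NM NV]] NJ] := nN.
have prodL m x : prodn L m x -> L x.
  by move=> hx; apply: (commGN_subN nL); apply/(commGNP _ nL); exists m.
have cN := commGN_subN nN.
(* Products of power sequences are not power sequences, so [z] is any sequence in [G,N] along which
   [nu] has slope [r] up to a bounded error. *)
pose S0 (w : gseq G) (r : RR) := exists (z : gseq G) K (C : RR),
  forall n, [/\ commGN N (z n), prodn L K (w n * (z n)^-1)%g & `|nu (z n) - n%:R * r| <= C].
have [|mu [qm dm e]] := @QG_of_graph L D S0 nL D0.
  split.
  - move=> w r [z [K [C h]]] n; have [hz hw _] := h n.
    rewrite -(mulgVK (z n) (w n)); apply: LM; first exact: prodL hw.
    exact/NL/cN.
  - move=> a b r s [z [K [C h]]] [z' [K' [C' h']]].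
    exists (z * z')%g, (K' + K)%N, (C + C' + E) => n.
    have [hz ha la] := h n; have [hz' hb lb] := h' n; split.
    + exact: gen_mul.
    + rewrite (_ : (_ * _)%g =
        (a n * (b n * (z' n)^-1) * (a n)^-1 * (a n * (z n)^-1))%g).
        by apply: prodnM => //; apply: prodn_conj.
      rewrite (_ : (a * b)%g n = (a n * b n)%g)//.
      by rewrite (_ : (z * z')%g n = (z n * z' n)%g)//; group_words.
    + have := dE _ _ (cN _ hz) (cN _ hz'); move: la lb.
      rewrite (_ : (z * z')%g n = (z n * z' n)%g)// mulrDr !ler_norml.
      by move=> /andP[a1 a2] /andP[b1 b2] /andP[c1 c2]; apply/andP; split; lra.
  - move=> a r [z [K [C h]]]; exists (z^-1)%g, K, C => n.
    have [hz ha la] := h n; split.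
    + exact: gen_inv.
    + rewrite (_ : (_ * _)%g = ((a n)^-1 * (a n * (z n)^-1)^-1 * (a n)^-1^-1)%g).
        by apply: prodn_conj => //; apply: prodnV.
      rewrite (_ : (a^-1)%g n = (a n)^-1%g)//.
      by rewrite (_ : (z^-1)%g n = (z n)^-1%g)//; group_words.
    + rewrite (_ : (z^-1)%g n = (z n)^-1%g)// (QG_V q) ?mulrN; last exact: cN.
      by rewrite -opprD normrN.
  - move=> a b La Lb; exists 1%g, 1%N, 0 => n; split.
    + exact: gen_one.
    + by rewrite invg1 mulg1; apply: (prodn_comm (a n) (Lb n)).
    + by rewrite (QG_1 nN q) mulr0 subr0 normr0.
  - move=> a r t [z [K [C h]]] [C' h'].
    apply: (@multiples_le _ _ (C + K%:R * D + C')) => n.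
    have [hz ha la] := h n; have [m [hm lm]] := h' n.
    have : prodn L (K + m) (z n).
      have -> : (z n = (a n * (z n)^-1)^-1 * a n)%g by group_words.
      by apply: prodnM => //; apply: prodnV.
    move/(hD _ _ hz); move: la; rewrite natrD mulrDl !ler_norml.
    by move=> /andP[a1 a2] /andP[b1 b2]; lra.
have emu z : commGN N z -> mu z = nu z.
  move=> hz; apply: e; exists (powers z), 0%N, 0 => n; split.
  - by apply: subgroup_exp hz; case: (commGN_normal nN).
  - by rewrite mulgV; apply: prodn1.
  - by rewrite /powers (QG_X n q) ?subrr ?normr0//; apply: cN.
exists (fun x => nu x - mu x), mu; split=> //; last by move=> x _; rewrite subrK.
apply: QG_vanishing_hom => //; last by move=> z hz; rewrite emu// subrr.
have [hq _] := q; have [hm [_ im]] := qm; split; [|split].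
- by move=> x k Nx; rewrite hq// hm; [rewrite mulrBr|apply: NL].
- exists (E + D) => x y Nx Ny; have := dE _ _ Nx Ny; have := dm _ _ (NL _ Nx) (NL _ Ny).
  rewrite !ler_norml => /andP[a1 a2] /andP[b1 b2].
  by apply/andP; split; lra.
- by move=> g x Nx; rewrite inv// im//; apply: NL.
Qed.

End Quasimorphisms.

(** * Bilinear forms of quasimorphisms *)

(** A basis is chosen greedily. If no [v t0] left the row space of [A], every column of the cokernel
    of [A] would be killed by all [v t], so [A] would have rank [l] with only [k < l] rows. *)
Lemma separating_family_unit (F : fieldType) (T : Type) (l : nat) (v : T -> 'rV[F]_l) :
  (forall c : 'cV[F]_l, (forall t, v t *m c = 0) -> c = 0) ->
  exists t : 'I_l -> T, (\matrix_(j < l) v (t j)) \in unitmx.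
Proof.
move=> sep.
suff h k : (k <= l)%N -> exists t : 'I_k -> T, row_free (\matrix_(j < k) v (t j)).
  by have [t] := h l (leqnn l); rewrite row_free_unit => ht; exists t.
elim: k => [_|k IH kl].
  have t0 : 'I_0 -> T by case.
  by exists t0; rewrite /row_free eqn_leq rank_leq_row.
have [t ht] := IH (ltnW kl); set A := \matrix_(j < k) _ in ht.
have [[t0 [c [Ac0 tc]]]|none] :=
    pselect (exists t0 (c : 'cV[F]_l), A *m c = 0 /\ v t0 *m c <> 0); last first.
  have coker0 : cokermx A = 0.
    apply/matrixP => i j; rewrite [RHS]mxE.
    have : col j (cokermx A) = 0.
      apply: sep => t0; apply: contrapT => tc; apply: none.
      exists t0, (col j (cokermx A)); split=> //.
      by rewrite colE mulmxA mulmx_coker mul0mx.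
    by move/colP/(_ i); rewrite !mxE.
  have := mxrank_coker A; rewrite coker0 mxrank0 => /esym/eqP.
  by rewrite subn_eq0 leqNgt (leq_ltn_trans (rank_leq_row A) kl).
pose t' (j : 'I_(1 + k)) := match fintype.split j with inl _ => t0 | inr i => t i end.
exists (t' : 'I_k.+1 -> T).
have -> : (\matrix_(j < k.+1) v (t' j)) = col_mx (v t0) A :> 'M[F]_(1 + k, l).
  apply/matrixP => i j; rewrite !mxE /t'; case: (fintype.split i) => i'; rewrite ?mxE//.
  by rewrite ord1.
apply: (@inj_row_free _ (1 + k)%N l) => w; rewrite -(hsubmxK w) mul_row_col.
move: (lsubmx _) (rsubmx _) => a w' e.
have a0 : a = 0.
  have /(congr1 (mulmx^~ c)) := e.
  rewrite mulmxDl -!mulmxA Ac0 mulmx0 addr0 mul0mx.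
  rewrite [a]mx11_scalar mul_scalar_mx => /eqP; rewrite scaler_eq0.
  case/orP => [/eqP ->|/eqP //]; first by rewrite raddf0.
move: e; rewrite a0 mul0mx add0r => /eqP; rewrite mulmx_free_eq0// => /eqP ->.
by rewrite row_mx0.
Qed.

Section LinearCombinations.
Variables (G : groupType) (N : G -> Prop).
Implicit Types nu : G -> RR.

Lemma defect_add nu nu' D D' : defect_le N nu D -> defect_le N nu' D' ->
  defect_le N (fun x => nu x + nu' x) (D + D').
Proof.
move=> d d' x y Nx Ny; apply: le_trans (lerD (d x y Nx Ny) (d' x y Nx Ny)).
by apply: le_trans (ler_normD _ _); rewrite le_eqVlt; apply/orP; left; apply/eqP; congr `|_|; ring.
Qed.

Lemma defect_sum l (c D : 'I_l -> RR) (nu : 'I_l -> G -> RR) :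
  (forall i, defect_le N (nu i) (D i)) ->
  defect_le N (fun x => \sum_i c i * nu i x) (\sum_i `|c i| * D i).
Proof.
move=> d x y Nx Ny; rewrite -!sumrB; apply: le_trans (ler_norm_sum _ _ _) _.
apply: ler_sum => i _; rewrite -!mulrBr normrM; apply: ler_wpM2l => //.
exact: d.
Qed.

Lemma QG_add nu nu' : QG N nu -> QG N nu' -> QG N (fun x => nu x + nu' x).
Proof.
move=> [h [[D d] i]] [h' [[D' d'] i']]; split; [|split].
- by move=> x k Nx; rewrite h// h'// mulrDr.
- by exists (D + D'); apply: defect_add.
- by move=> g x Nx; rewrite i// i'.
Qed.

Lemma QG_defects l (nu : 'I_l -> G -> RR) : (forall i, QG N (nu i)) ->
  exists D : 'I_l -> RR, forall i, defect_le N (nu i) (D i).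
Proof.
move=> q; have /choice[D hD] : forall i, exists D, defect_le N (nu i) D.
  by move=> i; have [_ [[D d] _]] := q i; exists D.
by exists D.
Qed.

Lemma QG_sum l (c : 'I_l -> RR) (nu : 'I_l -> G -> RR) :
  (forall i, QG N (nu i)) -> QG N (fun x => \sum_i c i * nu i x).
Proof.
move=> q; have [D d] := QG_defects q; split; [|split].
- move=> x k Nx; rewrite mulr_sumr; apply: eq_bigr => i _.
  by have [h _] := q i; rewrite h// mulrCA.
- by eexists; apply: defect_sum d.
- by move=> g x Nx; apply: eq_bigr => i _; have [_ [_ ->]] := q i.
Qed.

End LinearCombinations.

Section CommutatorForms.
Variables (G : groupType) (L N : G -> Prop).
Hypotheses (nL : is_normal L) (nN : is_normal N).
Hypothesis NL : forall x, N x -> L x.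
Hypothesis LN : forall g x, L x -> N (comm g x).
Implicit Types (nu : G -> RR) (b : G -> G -> RR) (s : seq (G * G)).

Definition bilinear_form b : Prop :=
  (forall g h x, L x -> b (g * h)%g x = b g x + b h x) /\
  (forall g x y, L x -> L y -> b g (x * y)%g = b g x + b g y).

Definition near_form nu b (C : RR) : Prop :=
  forall g x, L x -> `|nu (comm g x) - b g x| <= C.

Lemma bilinear_Xl b g x n : bilinear_form b -> L x -> b (g ^+ n)%g x = n%:R * b g x.
Proof.
move=> [bl _] Lx; elim: n => [|n IH]; last by rewrite expgS bl// IH -natr1; ring.
by rewrite mul0r; have := bl 1%g 1%g x Lx; rewrite mulg1 expg0; lra.
Qed.

Lemma bilinear_Vl b g x : bilinear_form b -> L x -> b (g^-1)%g x = - b g x.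
Proof.
move=> B Lx; have := B.1 g g^-1%g x Lx; rewrite mulgV.
by have := bilinear_Xl g 0 B Lx; rewrite mul0r expg0; lra.
Qed.

Lemma bilinear_zpow b g x k : bilinear_form b -> L x ->
  b (zpow g k) x = k%:~R * b g x.
Proof.
move=> B Lx; case: k => n /=; first by rewrite (bilinear_Xl g n B Lx) pmulrn.
by rewrite bilinear_Vl// (bilinear_Xl g n.+1 B Lx) NegzE mulrNz -pmulrn mulNr.
Qed.

Lemma bilinear_bounded_eq0 b C : bilinear_form b ->
  (forall g x, L x -> `|b g x| <= C) -> forall g x, L x -> b g x = 0.
Proof.
move=> B bC g x Lx; apply: (@multiples_bounded_eq0 _ C) => n.
by rewrite -(bilinear_Xl g n B Lx); apply: bC.
Qed.

(* For fixed [x], [g |-> nu [g, x]] is a quasimorphism, and so is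
   [x |-> nu [g, x]] for fixed [g], with the same defect: homogenizing in [g]
   gives a form within [D], which uniformity forces to be bilinear. *)
Lemma near_form_exists nu D : QG N nu -> defect_le N nu D ->
  exists b, bilinear_form b /\ near_form nu b D.
Proof.
move=> q d; have [_ [_ inv]] := q; have D0 := defect_ge0 nN d.
have addl g h x : L x ->
    `|nu (comm (g * h)%g x) - nu (comm g x) - nu (comm h x)| <= D.
  move=> Lx; have [_ NJ] := nN; rewrite comm_mull.
  have := d _ _ (NJ g _ (LN h Lx)) (LN g Lx); rewrite inv; last exact: LN.
  by rewrite addrAC.
have addr g x y : L x -> L y ->
    `|nu (comm g (x * y)%g) - nu (comm g x) - nu (comm g y)| <= D.
  move=> Lx Ly; have [_ NJ] := nN; rewrite comm_mulr.
  by have := d _ _ (LN g Lx) (NJ x _ (LN g Ly)); rewrite inv//; apply: LN.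
have mulX g x n k : L x ->
    `|nu (comm (g ^+ (n.+1 * k)) x)%g - n.+1%:R * nu (comm (g ^+ k)%g x)| <= n%:R * D.
  move=> Lx; elim: n => [|n IH]; first by rewrite mul1n mul1r subrr normr0 mul0r.
  have := addl (g ^+ k)%g (g ^+ (n.+1 * k))%g x Lx; rewrite -expgnDr -mulSn.
  move: IH; rewrite -!natr1 !ler_norml.
  by move=> /andP[a1 a2] /andP[b1 b2]; apply/andP; split; lra.
have /choice[b hb] : forall p : G * G, exists t, L p.2 -> forall n,
    `|nu (comm (p.1 ^+ n)%g p.2) - n%:R * t| <= D.
  move=> [g x] /=; have [Lx|nLx] := pselect (L x); last by exists 0 => /nLx.
  pose a n := nu (comm (g ^+ n)%g x).
  (* Homogenization by a cut instead of a limit: comparison with [a (n.+1 * m.+1)] shows that every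
     lower end lies below every upper end, and the common point is within [D] at every power. *)
  have [||x1 y1 [n ->] [m ->]|t [tA tB]] := @cut_between
      (fun r => exists n, r = (a n.+1 - D) / n.+1%:R)
      (fun r => exists n, r = (a n.+1 + D) / n.+1%:R).
  - by eexists; exists 0%N.
  - by eexists; exists 0%N.
  - rewrite ler_pdivrMr// mulrAC ler_pdivlMr//.
    have := mulX g x m n.+1 Lx; have := mulX g x n m.+1 Lx.
    rewrite (mulnC n.+1) -/(a _) -/(a _) -/(a _) -!natr1 !ler_norml.
    by move=> /andP[a1 a2] /andP[b1 b2]; lra.
  exists t => _ [|n].
    by rewrite expg0 comm_1l (QG_1 nN q) mul0r subrr normr0.
  have h1 := tA _ (ex_intro _ n erefl); have h2 := tB _ (ex_intro _ n erefl).
  move: h1 h2; rewrite ler_pdivrMr// ler_pdivlMr// /a mulrC => h1 h2.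
  by rewrite ler_norml; apply/andP; split; lra.
pose B g x := b (g, x).
have nB g x n : L x -> `|nu (comm (g ^+ n)%g x) - n%:R * B g x| <= D.
  by move=> Lx; apply: (hb (g, x)).
have near : near_form nu B D.
  by move=> g x Lx; have := nB g x 1%N Lx; rewrite mul1r.
have Br g x y : L x -> L y -> B g (x * y)%g = B g x + B g y.
  move=> Lx Ly; apply/eqP; rewrite -subr_eq0; apply/eqP.
  apply: (@multiples_bounded_eq0 _ (4 * D)) => n.
  have [[_ [LM _]] _] := nL.
  have := addr (g ^+ n)%g x y Lx Ly.
  have := nB g _ n (LM _ _ Lx Ly); have := nB g x n Lx; have := nB g y n Ly.
  rewrite !mulrDr mulrN mulrDr !ler_norml.
  by move=> /andP[a1 a2] /andP[b1 b2] /andP[c1 c2] /andP[d1 d2]; apply/andP; split; lra.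
have BX g x n : L x -> B g (x ^+ n)%g = n%:R * B g x.
  move=> Lx; have [sL _] := nL; have [L1 _] := sL; elim: n => [|n IH].
    by have := Br g 1%g 1%g L1 L1; rewrite mulg1 expg0 mul0r; lra.
  by rewrite expgS Br ?IH -?natr1; [ring| |apply: subgroup_exp].
exists B; split=> //; split=> // g h x Lx.
(* Powers of [g * h] do not split, so additivity in [g] is scaled through [x ^+ n], where [B] is
   already additive. The 4 counts three uses of [near] and one of [addl]. *)
apply/eqP; rewrite -subr_eq0; apply/eqP.
apply: (@multiples_bounded_eq0 _ (4 * D)) => n.
have Lxn : L (x ^+ n)%g by apply: subgroup_exp => //; case: nL.
have := addl g h _ Lxn; have := near (g * h)%g _ Lxn.
have := near g _ Lxn; have := near h _ Lxn; rewrite !BX//.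
rewrite !mulrDr mulrN mulrDr !ler_norml.
by move=> /andP[a1 a2] /andP[b1 b2] /andP[c1 c2] /andP[d1 d2]; apply/andP; split; lra.
Qed.

Definition form_sum b s : RR := \sum_(p <- s) b p.1 p.2.

Lemma near_form_prod nu b C D s : QG N nu -> defect_le N nu D -> near_form nu b C ->
  (forall p, p \in s -> L p.2) ->
  N (prod_comm s) /\ `|nu (prod_comm s) - form_sum b s| <= (size s)%:R * (C + D).
Proof.
move=> q d near; have [[N1 [NM _]] _] := nN.
elim: s => [|[g x] s IH] hs /=.
  by rewrite /form_sum big_nil (QG_1 nN q) subrr normr0 mul0r.
have Lx : L x by apply: (hs (g, x)); rewrite inE eqxx.
have [|Ns IHs] := IH; first by move=> p ps; apply: hs; rewrite inE ps orbT.
have Nc := LN g Lx; split; first exact: NM.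
have := d _ _ Nc Ns; have := near g x Lx; move: IHs.
rewrite /form_sum big_cons /= -natr1 !ler_norml.
by move=> /andP[a1 a2] /andP[b1 b2] /andP[c1 c2]; apply/andP; split; lra.
Qed.

Definition relation_seq s : Prop :=
  (forall p, p \in s -> L p.2) /\ commGN N (prod_comm s).

Lemma bilinear_sum l (c : 'I_l -> RR) (b : 'I_l -> G -> G -> RR) :
  (forall i, bilinear_form (b i)) ->
  bilinear_form (fun g x => \sum_i c i * b i g x).
Proof.
move=> B; split=> [g h x Lx|g x y Lx Ly]; rewrite -big_split /=; apply: eq_bigr => i _.
  by have [-> //] := B i; rewrite mulrDr.
by have [_ -> //] := B i; rewrite mulrDr.
Qed.

Lemma near_form_sum l (c C : 'I_l -> RR) (nu : 'I_l -> G -> RR)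
    (b : 'I_l -> G -> G -> RR) :
  (forall i, near_form (nu i) (b i) (C i)) ->
  near_form (fun x => \sum_i c i * nu i x) (fun g x => \sum_i c i * b i g x)
    (\sum_i `|c i| * C i).
Proof.
move=> near g x Lx; rewrite -sumrB; apply: le_trans (ler_norm_sum _ _ _) _.
apply: ler_sum => i _; rewrite -mulrBr normrM ler_wpM2l//; exact: near.
Qed.

Lemma form_sum_sum l (c : 'I_l -> RR) (b : 'I_l -> G -> G -> RR) s :
  form_sum (fun g x => \sum_i c i * b i g x) s = \sum_i c i * form_sum (b i) s.
Proof.
rewrite /form_sum exchange_big /=; apply: eq_bigr => i _.
by rewrite mulr_sumr.
Qed.

(* A quasimorphism whose form vanishes on relations is bounded by the number of
   (G,L)-commutators, hence extends to [L] up to a homomorphism. *)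
Lemma relation_forms_independent l (nu0 : 'I_l -> G -> RR)
    (b0 : 'I_l -> G -> G -> RR) (C0 : 'I_l -> RR) :
  (forall i, QG N (nu0 i)) ->
  (forall (c : 'I_l -> RR) (h mu : G -> RR), H1G N h -> QG L mu ->
     (forall x, N x -> \sum_i c i * nu0 i x = h x + mu x) -> forall i, c i = 0) ->
  (forall i, near_form (nu0 i) (b0 i) (C0 i)) ->
  forall c : 'I_l -> RR,
  (forall s, relation_seq s -> \sum_i c i * form_sum (b0 i) s = 0) ->
  forall i, c i = 0.
Proof.
move=> q ind near c hc.
have qs := QG_sum c q; have [D d] := QG_defects q.
have ds := defect_sum c d; have ns := near_form_sum c near.
set D1 := \sum_i _ in ds; set C1 := \sum_i _ in ns.
have D10 : 0 <= D1 by apply: defect_ge0 ds.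
have C10 : 0 <= C1.
  by have [[L1 _] _] := nL; apply: le_trans (normr_ge0 _) (ns 1%g 1%g L1).
have [||h [mu [hh qmu e]]] := @QG_extends _ _ _ _ (C1 + D1) nL nN NL qs.
- exact: addr_ge0.
- move=> k z hz [s [sk hs sz]].
  have rs : relation_seq s by split=> //; rewrite sz.
  by have [_] := near_form_prod qs ds ns hs; rewrite form_sum_sum (hc _ rs) subr0 sk sz.
exact: ind hh qmu e.
Qed.

(** On commutators of [L], [mu] is bounded, while [h] is exactly bilinear there by invariance. So
    [b1] is bilinear and bounded, hence zero. Along a relation the [h] terms add up to [h] of an
    element of [G,N], which is 0. *)
Lemma near_form_decomposition l (nu0 : 'I_l -> G -> RR)
    (b0 : 'I_l -> G -> G -> RR) (C0 : 'I_l -> RR) nu b C c h mu :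
  (forall i, bilinear_form (b0 i)) ->
  (forall i, near_form (nu0 i) (b0 i) (C0 i)) ->
  bilinear_form b -> near_form nu b C -> H1G N h -> QG L mu ->
  (forall x, N x -> nu x = \sum_i c i * nu0 i x + h x + mu x) ->
  forall s, relation_seq s -> form_sum b s = \sum_i c i * form_sum (b0 i) s.
Proof.
move=> B0 near0 B near [hM hinv] qmu e s [hs hz].
have [_ [[E dE] _]] := qmu; have ns := near_form_sum c near0.
set C1 := \sum_i _ in ns; have [[N1 [NM NV]] NJ] := nN.
have Bs := bilinear_sum c B0.
pose b1 g x := b g x - \sum_i c i * b0 i g x - h (comm g x).
have B1 : bilinear_form b1.
  split=> [g g' x Lx|g x y Lx Ly]; rewrite /b1.
    rewrite B.1// Bs.1// comm_mull hM ?hinv; try exact: LN.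
      by ring.
    by apply: NJ; apply: LN.
  rewrite B.2// Bs.2// comm_mulr hM ?hinv; try exact: LN.
    by ring.
  by apply: NJ; apply: LN.
have b10 g x : L x -> b1 g x = 0.
  apply: (@bilinear_bounded_eq0 b1 (C + C1 + E)) => // {}g {}x Lx.
  have := near g x Lx; have := ns g x Lx; have := QG_le_comm nL qmu dE g Lx.
  rewrite /b1 e; last exact: LN.
  by rewrite !ler_norml => /andP[a1 a2] /andP[a3 a4] /andP[a5 a6]; apply/andP; split; lra.
have h0 z : commGN N z -> h z = 0.
  have hV x : N x -> h x^-1%g = - h x.
    move=> Nx; have := hM 1%g 1%g N1 N1; have := hM x x^-1%g Nx (NV _ Nx).
    by rewrite mulgV mulg1; lra.
  have h1 : h 1%g = 0 by have := hM 1%g 1%g N1 N1; rewrite mulg1; lra.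
  elim=> [_ [g [x [Nx ->]]]||x1 y1 g1 e1 g2 e2|x1 g1 e1] //.
  - by rewrite /comm hM ?hinv ?hV ?subrr//; [apply: NJ|apply: NV].
  - by rewrite hM ?e1 ?e2 ?addr0//; apply: commGN_subN.
  - by rewrite hV ?e1 ?oppr0//; apply: commGN_subN.
have hprod : N (prod_comm s) /\ h (prod_comm s) = \sum_(p <- s) h (comm p.1 p.2).
  elim: s hs {hz} => [|[g x] s IH] hs /=; first by rewrite big_nil h0//; apply: gen_one.
  have Lx : L x by apply: (hs (g, x)); rewrite inE eqxx.
  have [|Ns IHs] := IH; first by move=> p ps; apply: hs; rewrite inE ps orbT.
  by split; [apply: NM => //; apply: LN|rewrite big_cons hM ?IHs//; apply: LN].
rewrite -form_sum_sum; apply/eqP; rewrite -subr_eq0; apply/eqP.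
apply: eq_trans (h0 _ hz); rewrite hprod.2 /form_sum -sumrB; apply: eq_big_seq => p ps.
exact: subr0_eq (b10 p.1 p.2 (hs _ ps)).
Qed.

Lemma dual_basis l : dimW L N l ->
  exists (nu : 'I_l -> G -> RR) (b : 'I_l -> G -> G -> RR) (C : 'I_l -> RR)
    (ss : 'I_l -> seq (G * G)),
  [/\ forall i, QG N (nu i),
      forall i, bilinear_form (b i) /\ near_form (nu i) (b i) (C i),
      forall j, relation_seq (ss j),
      forall i j, form_sum (b i) (ss j) = (i == j)%:R &
      forall nu' b' C', QG N nu' -> bilinear_form b' -> near_form nu' b' C' ->
        forall s, relation_seq s ->
        form_sum b' s = \sum_i form_sum b' (ss i) * form_sum (b i) s].
Proof.
move=> [nu0 [q0 [ind span]]]; have [D0 d0] := QG_defects q0.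
have /choice[b0 hb0] : forall i, exists b, bilinear_form b /\ near_form (nu0 i) b (D0 i).
  by move=> i; apply: near_form_exists.
have B0 i := (hb0 i).1; have near0 i := (hb0 i).2.
pose v (s : {s | relation_seq s}) : 'rV[RR]_l := \row_i form_sum (b0 i) (sval s).
have [|t ht] := @separating_family_unit _ _ _ v.
  move=> c hc; apply/colP => i; rewrite [RHS]mxE.
  apply: (relation_forms_independent q0 ind near0 (c := fun i => c i 0)) => s hs.
  have /rowP/(_ 0) := hc (exist _ s hs); rewrite !mxE => e; rewrite -[RHS]e.
  by apply: eq_bigr => j _; rewrite !mxE mulrC.
set A := \matrix_j _ in ht; pose X := invmx A; pose ss j := sval (t j).
have Aji j i : A j i = form_sum (b0 i) (ss j) by rewrite !mxE.
exists (fun k x => \sum_i X i k * nu0 i x), (fun k g x => \sum_i X i k * b0 i g x),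
  (fun k => \sum_i `|X i k| * D0 i), ss; split.
- by move=> k; apply: QG_sum.
- by move=> k; split; [apply: bilinear_sum|apply: near_form_sum].
- by move=> j; exact: (svalP (t j)).
- move=> k j; rewrite form_sum_sum.
  have /matrixP/(_ j k) : A *m X = 1%:M by apply: mulmxV.
  rewrite !mxE eq_sym => <-; apply: eq_bigr => i _; by rewrite -Aji mulrC.
move=> nu' b' C' q' B' near' s hs.
have [c [h [mu [hh [qmu e]]]]] := span _ q'.
have dec := near_form_decomposition B0 near0 B' near' hh qmu e.
(* Evaluating the decomposition on the chosen relations gives the vector [A *m c], so the inverse
   [X] recovers the coefficients. *)
have Xc i : c i = \sum_k X i k * form_sum b' (ss k).
  have /matrixP/(_ i 0) : X *m (A *m (\col_i c i)) = \col_i c i.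
    by rewrite mulmxA mulVmx// mul1mx.
  rewrite [RHS]mxE => <-; rewrite mxE; apply: eq_bigr => k _; congr (_ * _).
  rewrite (dec (ss k)); last exact: (svalP (t k)).
  by rewrite mxE; apply: eq_bigr => m _; rewrite Aji mxE mulrC.
rewrite (dec s hs).
under [RHS]eq_bigr => k _ do rewrite form_sum_sum mulr_sumr.
rewrite exchange_big /=; apply: eq_bigr => i _; rewrite Xc mulr_suml.
by apply: eq_bigr => k _; ring.
Qed.

End CommutatorForms.

(** * The coarse kernel *)

Section IntegerVectors.
Variable l : nat.
Implicit Types m : Zl l.

Lemma dZE m m' : dZ m m' = \sum_i `|(m i)%:~R - (m' i)%:~R|.
Proof.
rewrite /dZ /norm1 raddf_sum; apply: eq_bigr => i _.
by rewrite !ffunE /= intr_norm intrB.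
Qed.

Definition pairing (y : 'I_l -> RR) m : RR := \sum_j (m j)%:~R * y j.

Lemma pairingD y m m' : pairing y (m + m') = pairing y m + pairing y m'.
Proof.
rewrite /pairing -big_split; apply: eq_bigr => j _ /=.
by rewrite ffunE intrD mulrDl.
Qed.

Lemma pairing_muln y m k : pairing y (m *+ k) = k%:R * pairing y m.
Proof.
elim: k => [|k IH]; last by rewrite mulrS pairingD IH -natr1; ring.
by rewrite mulr0n mul0r /pairing big1// => j _; rewrite ffunE mul0r.
Qed.

Lemma pairing_dist y m m' Y : (forall j, `|y j| <= Y) ->
  `|pairing y m' - pairing y m| <= Y * dZ m m'.
Proof.
move=> hY; rewrite /pairing -sumrB dZE mulr_sumr.
apply: le_trans (ler_norm_sum _ _ _) _; apply: ler_sum => j _.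
by rewrite -mulrBl normrM mulrC distrC ler_wpM2r.
Qed.

Definition unit_vector j : Zl l := [ffun i => (i == j)%:Z].

Lemma Zl_ind (Q : Zl l -> Prop) : Q 0 -> (forall m m', Q m -> Q m' -> Q (m + m')) ->
  (forall m, Q m -> Q (- m)) -> (forall j, Q (unit_vector j)) -> forall m, Q m.
Proof.
move=> Q0 QD QN Qe m.
have Qn j (n : nat) : Q (unit_vector j *+ n).
  by elim: n => [|n IH]; rewrite ?mulr0n// mulrS; apply: QD.
have -> : m = \sum_j unit_vector j *~ m j.
  apply/ffunP => i; rewrite sum_ffunE (bigD1 i)//= big1 => [|j ji].
    rewrite addr0; case: (m i) => n /=.
      by rewrite ffunMnE ffunE eqxx natz.
    by rewrite NegzE mulrNz ffunE ffunMnE ffunE eqxx natz.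
  case: (m j) => n; rewrite ?NegzE ?mulrNz !(ffunE, ffunMnE) eq_sym (negbTE ji).
    by rewrite mul0rn.
  by rewrite mul0rn oppr0.
apply: big_ind => // j _; case: (m j) => n; first exact: Qn.
by rewrite NegzE mulrNz; apply: QN; apply: Qn.
Qed.

End IntegerVectors.

(** * Words with scaled first entries *)

Section CommutatorWords.
Variables (G : groupType) (L N : G -> Prop) (l : nat).
Hypotheses (nL : is_normal L) (nN : is_normal N).
Hypothesis LN : forall g x, L x -> N (comm g x).
Implicit Types (S : seq ('I_l * (G * G))) (m : Zl l).

Definition scaled_pairs S m : seq (G * G) :=
  [seq (zpow p.2.1 (m p.1), p.2.2) | p <- S].

Definition word S m : G := prod_comm (scaled_pairs S m).

Definition pairs_in S : Prop := forall p, p \in S -> L p.2.2.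

Lemma scaled_pairs_in S m : pairs_in S -> forall p, p \in scaled_pairs S m -> L p.2.
Proof. by move=> hS p /mapP[p' p'S ->]; apply: hS. Qed.

Lemma word_prodn S m : pairs_in S -> prodn L (size S) (word S m).
Proof.
move=> hS; exists (scaled_pairs S m); split; [by rewrite size_map| |by []].
exact: scaled_pairs_in.
Qed.

Lemma word_in S m : pairs_in S -> N (word S m).
Proof.
rewrite /word; have [[N1 [NM _]] _] := nN; elim: S => [|p S IH] hS //=.
apply: NM; first by apply: LN; apply: hS; rewrite inE eqxx.
by apply: IH => p' p'S; apply: hS; rewrite inE p'S orbT.
Qed.

Lemma word_cat S S' m : word (S ++ S') m = (word S m * word S' m)%g.
Proof. by rewrite /word /scaled_pairs map_cat prod_comm_cat. Qed.

(** Modulo [G,N] the subgroup [N] is central: by [comm_mull] each commutator becomes additive in its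
    exponent, and the factors may be reordered. *)
Lemma wordD S m m' : pairs_in S ->
  commGN N (word S (m + m') * (word S m * word S m')^-1)%g.
Proof.
have [_ cJ] := commGN_normal nN; have [[N1 [NM _]] _] := nN.
elim: S => [|[j [g x]] S IH] hS; first by rewrite /word /= mulg1 mulgV; apply: gen_one.
have Lx : L x by apply: (hS (j, (g, x))); rewrite inE eqxx.
have hS' : pairs_in S by move=> p pS; apply: hS; rewrite inE pS orbT.
have := IH hS'; have := word_in m hS'.
rewrite -cat1s !word_cat; move: (word S (m + m')) (word S m) (word S m') => R R1 R2 NR1.
set c := (R * _)%g => hc.
have -> : R = (c * (R1 * R2))%g by rewrite /c mulgVK.
rewrite /word /= !mulg1 ffunE zpowD comm_mull.
set h := zpow g (m j); set h' := zpow g (m' j).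
have Nx1 : N (comm h x) by apply: LN.
have Nx2 : N (comm h' x) by apply: LN.
set x1 := comm h x in Nx1 *; set x2 := comm h' x in Nx2 *.
have -> : (h * x2 * h^-1 * x1 * (c * (R1 * R2)) * (x1 * R1 * (x2 * R2))^-1 =
  comm h x2 * ((x2 * x1) * c * (x2 * x1)^-1) * comm x2 (x1 * R1))%g.
  by group_words.
apply: gen_mul; first apply: gen_mul.
- by apply: gen_in; exists h, x2.
- exact: cJ.
- by apply: gen_in; exists x2, (x1 * R1)%g; split=> //; apply: NM.
Qed.

Lemma word0 S : word S 0 = 1%g.
Proof.
rewrite /word; elim: S => [|p S IH] //=.
by rewrite IH ffunE /= comm_1l mulg1.
Qed.

(** By [wordD] the word induces a homomorphism from Z^l to N/[G,N], which is trivial once it kills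
    the unit vectors. *)
Lemma word_commGN S : pairs_in S -> (forall j, commGN N (word S (unit_vector j))) ->
  forall m, commGN N (word S m).
Proof.
move=> hS he; apply: Zl_ind => //.
- by rewrite word0; apply: gen_one.
- move=> m m' hm hm'; have := wordD m m' hS => h.
  rewrite -(mulgVK (word S m * word S m')%g (word S (m + m'))).
  by apply: gen_mul => //; apply: gen_mul.
- move=> m hm; have := wordD m (- m) hS; rewrite subrr word0 mul1g => h.
  rewrite (_ : word S (- m) = ((word S m)^-1 * (word S m * word S (- m))^-1^-1)%g).
    by apply: gen_mul; apply: gen_inv.
  by group_words.
Qed.

Lemma near_form_word nu b C D S m : QG N nu -> defect_le N nu D ->
  bilinear_form L b -> near_form L nu b C -> pairs_in S ->
  `|nu (word S m) - \sum_(p <- S) (m p.1)%:~R * b p.2.1 p.2.2| <= (size S)%:R * (C + D).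
Proof.
move=> q d B near hS.
have [_] := near_form_prod nN LN q d near (@scaled_pairs_in S m hS).
rewrite size_map /form_sum big_map; congr (`|_ - _| <= _).
by apply: eq_big_seq => p pS /=; rewrite (bilinear_zpow _ _ B)//; apply: hS.
Qed.

Section Generators.
Variable ss : 'I_l -> seq (G * G).
Hypothesis hss : forall j, relation_seq L N (ss j).

Definition generators (r : seq 'I_l) : seq ('I_l * (G * G)) :=
  flatten [seq [seq (j, p) | p <- ss j] | j <- r].

Lemma generators_in r : pairs_in (generators r).
Proof.
move=> p /flatten_mapP[j _ /mapP[p' p's ->]] /=.
by have [h _] := hss j; apply: h.
Qed.

Lemma word_unit_vector j r : uniq r ->
  word (generators r) (unit_vector j) = if j \in r then prod_comm (ss j) else 1%g.
Proof.
elim: r => [|i r IH] //= /andP[ir ur].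
rewrite /generators /= word_cat -/(generators r) IH// inE.
have e : word [seq (i, p) | p <- ss i] (unit_vector j) =
    if j == i then prod_comm (ss i) else 1%g.
  rewrite /word /scaled_pairs -map_comp; elim: (ss i) => [|[g x] s IHs] /=.
    by case: ifP.
  rewrite IHs ffunE eq_sym; case: (j == i) => //=.
  by rewrite comm_1l mulg1.
rewrite e; case: eqVneq => [->|_] /=; last by rewrite mul1g.
by rewrite (negbTE ir) mulg1.
Qed.

Lemma big_generators r (F : 'I_l -> G * G -> RR) :
  \sum_(p <- generators r) F p.1 p.2 = \sum_(j <- r) \sum_(p <- ss j) F j p.
Proof.
by rewrite /generators big_flatten big_map; apply: eq_bigr => j _; rewrite big_map.
Qed.

End Generators.

End CommutatorWords.

Definition coarse_kernel_maps (G : groupType) (L N : G -> Prop) (l : nat)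
    (Phi : G -> Zl l) (Psi : Zl l -> G) : Prop :=
  let GN := commGN N in
  let dN := dscl N in
  let dL := dscl L in
  let Im := fun y => exists m, y = Psi m in
    (forall m, GN (Psi m)) /\
    (exists C : RR, forall g g', GN g -> GN g' ->
        dZ (Phi (g * g')%g) (Phi g + Phi g') <= C) /\
    (exists C : RR, forall m m', dN (Psi (m + m')) (Psi m * Psi m')%g <= C) /\
    dbounded dL Im /\
    qi_embedding_on (fun _ => True) (@dZ l) dN Psi /\
    (forall A : G -> Prop, (forall y, A y -> GN y) -> dbounded dL A ->
        qi_embedding_on A dN (@dZ l) Phi) /\
    (forall A : G -> Prop, (forall y, A y -> GN y) -> dbounded dL A ->
        exists C : RR, forall y, A y -> dN y (Psi (Phi y)) <= C) /\
    (exists C : RR, forall m, norm1 (Phi (Psi m) - m) <= C) /\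
    (dbounded dL Im /\
     forall B : G -> Prop, (forall y, B y -> GN y) -> dbounded dL B ->
       exists D : RR, 0 <= D /\ forall b, B b -> forall eps : RR, 0 < eps ->
         exists a, Im a /\ dN a b <= D + eps) /\
    controlled_on (fun _ => True) (@dZ l) dN Psi /\
    controlled_on Im dN (@dZ l) Phi /\
    (exists C : RR, forall m, dZ (Phi (Psi m)) m <= C) /\
    (exists C : RR, forall y, Im y -> dN (Psi (Phi y)) y <= C) /\
    (forall m, Phi (Psi m) = m).

(** * Estimates for the two maps *)

Section CoarseKernel.
Variables (G : groupType) (L N : G -> Prop) (l : nat).
Hypotheses (nL : is_normal L) (nN : is_normal N).
Hypothesis NL : forall x, N x -> L x.
Hypothesis LN : forall g x, L x -> N (comm g x).
Variables (nu : 'I_l -> G -> RR) (b : 'I_l -> G -> G -> RR) (C D : 'I_l -> RR).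
Variable ss : 'I_l -> seq (G * G).
Hypothesis q : forall i, QG N (nu i).
Hypothesis d : forall i, defect_le N (nu i) (D i).
Hypothesis B : forall i, bilinear_form L (b i).
Hypothesis near : forall i, near_form L (nu i) (b i) (C i).
Hypothesis hss : forall j, relation_seq L N (ss j).
Hypothesis dual : forall i j, form_sum (b i) (ss j) = (i == j)%:R.
Hypothesis span : forall nu' b' C', QG N nu' -> bilinear_form L b' ->
  near_form L nu' b' C' -> forall s, relation_seq L N s ->
  form_sum b' s = \sum_i form_sum b' (ss i) * form_sum (b i) s.

Let gens := generators ss (enum 'I_l).
Let psi (m : Zl l) : G := word gens m.
Let size_gens : RR := (size gens)%:R.

Let gens_in : pairs_in L gens. Proof. exact: generators_in. Qed.

Let D0 i : 0 <= D i. Proof. exact: defect_ge0 nN (@d i). Qed.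

Let C0 i : 0 <= C i.
Proof. by have [[L1 _] _] := nL; apply: le_trans (normr_ge0 _) (near i 1%g L1). Qed.

Let cN z : commGN N z -> N z. Proof. exact: commGN_subN. Qed.

Lemma psi_in m : commGN N (psi m).
Proof.
apply: (word_commGN nN LN gens_in) => j.
by rewrite word_unit_vector ?enum_uniq// mem_enum; have [_] := hss j.
Qed.

Lemma psi_prodn m : prodn L (size gens) (psi m).
Proof. exact: word_prodn. Qed.

Lemma near_form_psi nu' b' C' D' m : QG N nu' -> defect_le N nu' D' ->
  bilinear_form L b' -> near_form L nu' b' C' ->
  `|nu' (psi m) - pairing (fun j => form_sum b' (ss j)) m| <= size_gens * (C' + D').
Proof.
move=> q' d' B' n'; have := near_form_word nN LN m q' d' B' n' gens_in.
rewrite (big_generators ss _ (fun j p => (m j)%:~R * b' p.1 p.2)) big_enum /=.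
by congr (`|_ - _| <= _); apply: eq_bigr => j _; rewrite -mulr_sumr.
Qed.

Definition psi_error : RR := \sum_i size_gens * (C i + D i).

Lemma nu_psi i m : `|nu i (psi m) - (m i)%:~R| <= psi_error.
Proof.
have := near_form_psi m (q i) (@d i) (B i) (@near i).
rewrite /pairing (bigD1 i)//= dual eqxx mulr1 big1 ?addr0; last first.
  by move=> j ji; rewrite dual eq_sym (negbTE ji) mulr0.
move/le_trans; apply; rewrite /psi_error (bigD1 i)//= lerDl sumr_ge0// => j _.
by rewrite mulr_ge0// ?ler0n// addr_ge0.
Qed.

(** A sum stands in for a maximum over [j]. For defect 1 the value on a relation is at most
    [2 * scl], and each of its commutators adds an error [1 + 1] when passing to the form. *)
Definition value_bound : RR :=
  \sum_j (2 * scl N (prod_comm (ss j)) + (size (ss j))%:R * 2).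

Lemma form_sum_bound nu' b' : QG N nu' -> defect_le N nu' 1 -> near_form L nu' b' 1 ->
  forall j, `|form_sum b' (ss j)| <= value_bound.
Proof.
move=> q' d' n' j; have [hL hN] := hss j.
have [_] := near_form_prod nN LN q' d' n' hL.
have := QG_le_scl nN q' d' hN.
have le_sum : 2 * scl N (prod_comm (ss j)) + (size (ss j))%:R * 2 <= value_bound.
  rewrite /value_bound (bigD1 j)//= lerDl sumr_ge0// => i _.
  by rewrite addr_ge0// ?mulr_ge0// scl_ge0//; have [] := hss i.
rewrite !ler_norml => /andP[a1 a2] /andP[b1 b2].
by apply/andP; split; lra.
Qed.

Lemma unit_QG_form nu' : QG N nu' -> defect_le N nu' 1 ->
  exists y : 'I_l -> RR, exists b', [/\ bilinear_form L b', near_form L nu' b' 1,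
   forall j, y j = form_sum b' (ss j), forall j, `|y j| <= value_bound &
   forall m, `|nu' (psi m) - pairing y m| <= size_gens * 2].
Proof.
move=> q' d'; have [b' [B' n']] := near_form_exists nL nN LN q' d'.
exists (fun j => form_sum b' (ss j)), b'; split=> // [j|m].
  exact: form_sum_bound n' j.
exact: near_form_psi.
Qed.

Lemma value_bound_ge0 : 0 <= value_bound.
Proof.
by apply: sumr_ge0 => j _; rewrite addr_ge0// ?mulr_ge0// scl_ge0//; have [] := hss j.
Qed.

(* Subtracting the combination of the [nu i] dual to the relations leaves a
   quasimorphism whose form vanishes on relations; it is then controlled by the
   number of (G,L)-commutators. *)
Lemma scl_key z : commGN N z ->
  scl N z <= value_bound * (\sum_i `|nu i z|)
    + (2 + value_bound * \sum_i (C i + D i)) * scl L z.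
Proof.
move=> hz; have hzL : commGN L z by apply: commGN_sub hz.
apply: scl_le_QG => // nu' q' d'.
have [y [b' [B' n' ey hy _]]] := unit_QG_form q' d'.
pose mu x := nu' x + \sum_i (- y i) * nu i x.
pose bm g x := b' g x + \sum_i (- y i) * b i g x.
have qm : QG N mu by apply: QG_add q' _; apply: QG_sum.
have dm : defect_le N mu (1 + \sum_i `|- y i| * D i).
  by apply: defect_add d' _; apply: defect_sum.
have nm : near_form L mu bm (1 + \sum_i `|- y i| * C i).
  have ns := near_form_sum (fun i => - y i) near.
  move=> g x Lx; have := n' g x Lx; have := ns g x Lx.
  rewrite /mu /bm !ler_norml => /andP[a1 a2] /andP[b1 b2].
  by apply/andP; split; lra.
set Dm := 1 + _ in dm; set Cm := 1 + _ in nm.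
have bm0 s : relation_seq L N s -> form_sum bm s = 0.
  move=> hs; have -> : form_sum bm s = form_sum b' s +
      form_sum (fun g x => \sum_i (- y i) * b i g x) s.
    by rewrite /form_sum -big_split.
  rewrite (form_sum_sum (fun i => - y i)) (span q' B' n' hs) -big_split big1// => i _ /=.
  by rewrite ey mulNr subrr.
have CDm : Cm + Dm <= 2 + value_bound * \sum_i (C i + D i).
  rewrite /Cm /Dm mulr_sumr.
  have : \sum_i `|- y i| * C i + \sum_i `|- y i| * D i
      <= \sum_i value_bound * (C i + D i).
    rewrite -big_split; apply: ler_sum => i _ /=; rewrite -mulrDr normrN.
    by apply: ler_wpM2r (hy i); apply: addr_ge0.
  lra.
have CD0 : 0 <= Cm + Dm.
  by rewrite addr_ge0// addr_ge0// sumr_ge0// => i _; rewrite mulr_ge0.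
(* Since [z ^+ n] lies in [G,N], each of its expressions by (G,L)-commutators is a relation, on
   which the form of [mu] sums to 0; only the error per commutator remains. *)
have lemu : `|mu z| <= (Cm + Dm) * scl L z.
  apply: le_scl => // n k [s [sk hs sz]].
  have hzn : commGN N (z ^+ n)%g by apply: subgroup_exp hz; case: (commGN_normal nN).
  have rs : relation_seq L N s by split=> //; rewrite sz.
  have [_] := near_form_prod nN LN qm dm nm hs.
  by rewrite bm0// subr0 sz sk (QG_X n qm) ?normrM ?normr_nat//; apply: cN.
have e : nu' z = mu z + \sum_i y i * nu i z.
  by rewrite /mu -addrA -big_split big1 ?addr0// => i _ /=; rewrite mulNr addNr.
rewrite e addrC; apply: le_trans (ler_normD _ _) _; apply: lerD.
  apply: le_trans (ler_norm_sum _ _ _) _; rewrite mulr_sumr.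
  by apply: ler_sum => i _; rewrite normrM ler_wpM2r.
apply: le_trans lemu _; apply: ler_wpM2r CDm; exact: scl_ge0.
Qed.

Lemma quotient_in x y : commGN N x -> commGN N y -> commGN N (x^-1 * y)%g.
Proof. by move=> hx hy; apply: gen_mul => //; apply: gen_inv. Qed.

Let scl0 z : commGN N z -> 0 <= scl N z. Proof. exact: scl_ge0. Qed.

Section Rounding.
Variable k : nat.
(** Half of [k] must strictly exceed the error of [nu i] on words, so that rounding to the nearest
    integer returns [m]; the added 1 gives strictness and [k >= 1]. *)
Hypothesis hk : 2 * psi_error + 1 <= k%:R.

Let Psi (m : Zl l) : G := psi (m *+ k).
Let Phi (y : G) : Zl l := [ffun i => Num.floor (nu i y / k%:R + 1 / 2)].

Let error_ge0 : 0 <= psi_error.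
Proof. by apply: sumr_ge0 => i _; rewrite mulr_ge0// ?ler0n// addr_ge0. Qed.

Let k_ge1 : 1 <= k%:R :> RR. Proof. by move: error_ge0 hk; lra. Qed.

Let k_gt0 : 0 < k%:R :> RR. Proof. exact: lt_le_trans ltr01 k_ge1. Qed.

Lemma le_scale (x : RR) : 0 <= x -> x <= k%:R * x.
Proof. by move=> x0; rewrite ler_peMl. Qed.

Lemma Phi_near i y : `|k%:R * (Phi y i)%:~R - nu i y| <= k%:R.
Proof.
rewrite ffunE; have /andP[] := floor_itv (nu i y / k%:R + 1 / 2).
move: (Num.floor _) => f h1 h2; rewrite intrD in h2.
have e : nu i y = k%:R * (nu i y / k%:R) by rewrite mulrC divfK// gt_eqF.
have := ler_wpM2l (ltW k_gt0) h1; have := ler_wpM2l (ltW k_gt0) (ltW h2).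
rewrite {3}e !mulrDr !mulrA mulr1 => a1 a2.
by move: k_ge1; rewrite ler_norml => k1; apply/andP; split; lra.
Qed.

Lemma nu_Psi i m : `|nu i (Psi m) - k%:R * (m i)%:~R| <= psi_error.
Proof.
have e : ((m *+ k) i)%:~R = k%:R * (m i)%:~R :> RR.
  by rewrite ffunMnE -[m i *+ k]mulr_natl intrM natz.
by rewrite -e; apply: nu_psi.
Qed.

Lemma PhiPsi m : Phi (Psi m) = m.
Proof.
apply/ffunP => i; rewrite ffunE; apply: floor_def; rewrite intrD.
have := nu_Psi i m; rewrite ler_norml => /andP[h1 h2].
have -> : nu i (Psi m) / k%:R + 1 / 2 =
    (m i)%:~R + ((nu i (Psi m) - k%:R * (m i)%:~R + k%:R / 2) / k%:R).
  by field; rewrite gt_eqF.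
rewrite lerDl ltrD2l divr_ge0 ?ler0n//=; last by move: hk; lra.
by rewrite ltr_pdivrMr// mul1r; move: hk; lra.
Qed.

Lemma Psi_in m : commGN N (Psi m). Proof. exact: psi_in. Qed.

(** Each of the two words contributes [size_gens * 2] to the constant, and the quotient one
    defect. *)
Lemma Psi_quotient m m' nu' : QG N nu' -> defect_le N nu' 1 ->
  `|nu' ((Psi m)^-1 * Psi m')%g|
    <= k%:R * value_bound * dZ m m' + (size_gens * 4 + 1).
Proof.
move=> q' d'; have [y [b' [_ _ _ hy hp]]] := unit_QG_form q' d'.
have := hp (m *+ k); have := hp (m' *+ k); have := pairing_dist m m' hy.
have := QG_divl nN q' d' (cN (Psi_in m)) (cN (Psi_in m')).
rewrite !pairing_muln -/(Psi m) -/(Psi m') => h1 h2 h3 h4.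
have := ler_wpM2l (ltW k_gt0) h2; rewrite -[X in X * `|_|]normr_nat -normrM.
move: h1 h3 h4; rewrite mulrBr !ler_norml !mulrA.
move=> /andP[a1 a2] /andP[b1 b2] /andP[c1 c2] /andP[d1 d2].
by apply/andP; split; lra.
Qed.

Lemma Phi_upper y y' : commGN N y -> commGN N y' ->
  dZ (Phi y) (Phi y') <=
    (2 * \sum_i D i) * scl N (y^-1 * y')%g + \sum_i (D i + 2).
Proof.
move=> hy hy'; have hz := quotient_in hy hy'; have s0 := scl0 hz.
rewrite dZE mulr_sumr mulr_suml -big_split; apply: ler_sum => i _ /=.
have := Phi_near i y; have := Phi_near i y'.
have := QG_divl nN (q i) (@d i) (cN hy) (cN hy').
have := QG_le_scl nN (q i) (@d i) hz; set s := scl N _.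
(* The inequality is checked after multiplication by [k], where [X <= k * X] suffices; making [X]
   opaque keeps [k * X] an atom for [lra]. *)
have X0 : 0 <= 2 * D i * s + D i by rewrite addr_ge0// mulr_ge0// mulr_ge0.
have := le_scale X0; have [X eX] : exists X, X = 2 * D i * s + D i by eexists.
rewrite -eX (_ : 2 * D i * s = X - D i); last by rewrite eX; ring.
rewrite (_ : X - D i + (D i + 2) = X + 2); last by ring.
move=> hX; rewrite !ler_norml => /andP[a1 a2] /andP[b1 b2] /andP[c1 c2] /andP[d1 d2].
by apply/andP; split; rewrite -(ler_pM2l k_gt0); lra.
Qed.

Let key_const := 2 + value_bound * \sum_i (C i + D i).

Let key_const_ge0 : 0 <= key_const.
Proof.
rewrite addr_ge0// mulr_ge0 ?value_bound_ge0// sumr_ge0// => i _; exact: addr_ge0.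
Qed.

Lemma Phi_lower y y' : commGN N y -> commGN N y' ->
  scl N (y^-1 * y')%g <= value_bound * k%:R * dZ (Phi y) (Phi y')
    + value_bound * (\sum_i (2 * k%:R + D i)) + key_const * scl L (y^-1 * y')%g.
Proof.
move=> hy hy'; have hz := quotient_in hy hy'; apply: le_trans (scl_key hz) _.
rewrite lerD2r -mulrA -mulrDr; apply: ler_wpM2l; first exact: value_bound_ge0.
rewrite dZE mulr_sumr -big_split; apply: ler_sum => i _ /=.
rewrite -[X in X * `|_|]normr_nat -normrM mulrBr.
have := Phi_near i y; have := Phi_near i y'.
have := QG_divl nN (q i) (@d i) (cN hy) (cN hy').
set u := k%:R * (Phi y i)%:~R; set u' := k%:R * (Phi y' i)%:~R => h1 h2 h3.
have := ler_norm (u - u'); have := ler_norm (- (u - u')); rewrite normrN.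
move: (`|u - u'|) h1 h2 h3 => w; rewrite !ler_norml.
move=> /andP[a1 a2] /andP[b1 b2] /andP[c1 c2] w1 w2.
by apply/andP; split; lra.
Qed.

(** Both terms of [scl_key] are bounded: [Psi (Phi y)] and [y] have nearly equal values under each
    [nu i], and [scl_divl] with base point [a] bounds [scl L] of the quotient, since words have
    fixed length. *)
Lemma PsiPhi_near y a A : commGN N y -> commGN N a -> scl L (a^-1 * y)%g <= A ->
  scl N (y^-1 * Psi (Phi y))%g <=
    value_bound * (\sum_i (psi_error + k%:R + D i))
    + key_const * (2 * A + 2 * scl L a + 2 * size_gens + 2).
Proof.
move=> hy ha hA; have hP := Psi_in (Phi y); have hz := quotient_in hy hP.
apply: le_trans (scl_key hz) _; apply: lerD.
  apply: ler_wpM2l; first exact: value_bound_ge0.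
  apply: ler_sum => i _; have := nu_Psi i (Phi y); have := Phi_near i y.
  have := QG_divl nN (q i) (@d i) (cN hy) (cN hP).
  rewrite !ler_norml => /andP[a1 a2] /andP[b1 b2] /andP[c1 c2].
  by apply/andP; split; lra.
apply: ler_wpM2l => //.
have sub z : commGN N z -> commGN L z by apply: commGN_sub.
have := scl_divl nL (sub _ ha) (sub _ hy) (sub _ hP).
have : scl L (Psi (Phi y)) <= size_gens by apply: scl_le_prodn => //; apply: psi_prodn.
by lra.
Qed.

Lemma Phi_Psi_coarse_kernel : coarse_kernel_maps L N Phi Psi.
Proof.
pose GN := commGN N; pose dN := dscl N; pose dL := dscl L.
pose Im y := exists m, y = Psi m; rewrite /coarse_kernel_maps -/GN -/dN -/dL -/Im.
have V0 := value_bound_ge0.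
have sD0 : 0 <= \sum_i D i by apply: sumr_ge0 => i _; apply: D0.
have upper0 : 0 <= \sum_i (D i + 2).
  by apply: sumr_ge0 => i _; rewrite addr_ge0.
have dZ0 (m m' : Zl l) : 0 <= dZ m m' by rewrite dZE sumr_ge0.
have dN0 y y' : GN y -> GN y' -> 0 <= dN y y'.
  by move=> hy hy'; apply: scl0; apply: quotient_in.
have PsiU m m' : dN (Psi m) (Psi m') <=
    k%:R * value_bound * dZ m m' + (size_gens * 4 + 1).
  apply: scl_le_QG => //; first by apply: quotient_in; apply: Psi_in.
  by move=> nu'; apply: Psi_quotient.
have kV0 : 0 <= k%:R * value_bound by rewrite mulr_ge0.
have sg0 : 0 <= size_gens by apply: ler0n.
have PhiU y y' : GN y -> GN y' ->
    dZ (Phi y) (Phi y') <= (2 * \sum_i D i) * dN y y' + \sum_i (D i + 2).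
  exact: Phi_upper.
have bdIm : dbounded dL Im.
  exists (size gens + size gens)%:R => _ _ [m ->] [m' ->].
  apply: scl_le_prodn => //; apply: prodnM; last exact: psi_prodn.
  by apply: prodnV => //; apply: psi_prodn.
have h5 (A : G -> Prop) : (forall y, A y -> GN y) -> dbounded dL A ->
    exists C : RR, forall y, A y -> dN y (Psi (Phi y)) <= C.
  move=> hA [c hc]; have [[a Aa]|nA] := pselect (exists a, A a); last first.
    by exists 0 => y Ay; exfalso; apply: nA; exists y.
  eexists => y Ay; apply: PsiPhi_near (hc _ _ Aa Ay); exact: hA.
split; first exact: Psi_in.
split.
  exists (\sum_i (D i + 3)) => g g' hg hg'; rewrite dZE; apply: ler_sum => i _.
  have := Phi_near i g; have := Phi_near i g'; have := Phi_near i (g * g')%g.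
  have := @d i _ _ (cN hg) (cN hg'); have := le_scale (D0 i).
  rewrite [X in _ - X%:~R]ffunE intrD !ler_norml.
  move=> hD /andP[a1 a2] /andP[b1 b2] /andP[c1 c2] /andP[d1 d2].
  by apply/andP; split; rewrite -(ler_pM2l k_gt0); lra.
split.
  (* Three words at [size_gens * 2] each, plus one defect for the product and one for the
     quotient. *)
  exists (size_gens * 6 + 2) => m m'.
  have hmm : GN (Psi m * Psi m')%g by apply: gen_mul; apply: Psi_in.
  apply: scl_le_QG => //; first by apply: quotient_in => //; apply: Psi_in.
  move=> nu' q' d'; have [y [b' [_ _ _ _ hp]]] := unit_QG_form q' d'.
  have := QG_divl nN q' d' (cN (Psi_in (m + m'))) (cN hmm).
  have := d' _ _ (cN (Psi_in m)) (cN (Psi_in m')).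
  have := hp (m *+ k); have := hp (m' *+ k); have := hp ((m + m') *+ k).
  rewrite !pairing_muln pairingD -/(Psi m) -/(Psi m') -/(Psi (m + m')) !ler_norml.
  move=> /andP[a1 a2] /andP[b1 b2] /andP[c1 c2] /andP[d1 d2] /andP[e1 e2].
  by apply/andP; split; lra.
split=> //.
split.
  (* The 1 keeps [K] invertible when all [D i] vanish, in particular for [l = 0]. *)
  pose K := 2 * (\sum_i D i) + 1; have K0 : 0 < K by rewrite /K; lra.
  exists K^-1, (k%:R * value_bound + 1), (K^-1 * \sum_i (D i + 2)), (size_gens * 4 + 1).
  split; first by rewrite invr_gt0.
  split; first by lra.
  split; first by rewrite mulr_ge0// invr_ge0 ltW.
  split; first by lra.
  move=> m m' _ _; split; last first.
    by have := PsiU m m'; have := dZ0 m m'; lra.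
  rewrite -mulrBr mulrC ler_pdivrMr//.
  have := PhiU _ _ (Psi_in m) (Psi_in m'); rewrite !PhiPsi.
  have := dN0 _ _ (Psi_in m) (Psi_in m'); rewrite /K mulrDr mulr1 [dN _ _ * _]mulrC.
  lra.
have h4 (A : G -> Prop) : (forall y, A y -> GN y) -> dbounded dL A ->
    qi_embedding_on A dN (@dZ l) Phi.
  move=> hA [c hc]; pose K := value_bound * k%:R + 1.
  have K0 : 0 < K by rewrite /K; move: kV0; lra.
  (* The absolute value is taken because [c] may be negative when [A] is empty. *)
  pose E := value_bound * (\sum_i (2 * k%:R + D i)) + key_const * `|c|.
  have E0 : 0 <= E.
    rewrite addr_ge0// mulr_ge0// sumr_ge0// => i _.
    by rewrite addr_ge0// mulr_ge0// ltW.
  exists K^-1, (2 * (\sum_i D i) + 1), (K^-1 * E), (\sum_i (D i + 2)).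
  split; first by rewrite invr_gt0.
  split; first by lra.
  split; first by rewrite mulr_ge0// invr_ge0 ltW.
  split=> // y y' Ay Ay'; have hy := hA _ Ay; have hy' := hA _ Ay'.
  split; last by have := PhiU _ _ hy hy'; have := dN0 _ _ hy hy'; lra.
  rewrite -mulrBr mulrC ler_pdivrMr//.
  have : key_const * dL y y' <= key_const * `|c|.
    by apply: ler_wpM2l => //; apply: le_trans (hc _ _ Ay Ay') (ler_norm _).
  have lower : dN y y' <= value_bound * k%:R * dZ (Phi y) (Phi y')
      + value_bound * (\sum_i (2 * k%:R + D i)) + key_const * dL y y'.
    exact: Phi_lower.
  have := dZ0 (Phi y) (Phi y'); rewrite /E /K mulrDr mulr1 [dZ _ _ * _]mulrC.
  lra.
split=> //.
split=> //.
have norm0 m : dZ (Phi (Psi m)) m = 0.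
  by rewrite PhiPsi dZE big1// => i _; rewrite subrr normr0.
split; first by exists 0 => m; rewrite -/(dZ _ _) norm0.
split.
  split=> // A hA bA; have [c hc] := h5 A hA bA.
  exists `|c|; split=> // y Ay eps e0; exists (Psi (Phi y)); split; first by eexists.
  have hy := hA _ Ay.
  have : dN (Psi (Phi y)) y <= dN y (Psi (Phi y)).
    rewrite /dN /dscl -[X in scl N X <= _]invgK invgM invgK.
    by apply: scl_inv => //; apply: quotient_in => //; apply: Psi_in.
  by have := hc _ Ay; have := ler_norm c; lra.
split.
  move=> s; exists (k%:R * value_bound * s + (size_gens * 4 + 1)) => m m' _ _ hs.
  by apply: le_trans (PsiU m m') _; rewrite lerD2r ler_wpM2l.
split.
  move=> s; exists (2 * (\sum_i D i) * s + \sum_i (D i + 2)) => y y' [m ->] [m' ->] hs.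
  apply: le_trans (PhiU _ _ (Psi_in m) (Psi_in m')) _.
  by rewrite lerD2r ler_wpM2l// mulr_ge0.
split; first by exists 0 => m; rewrite norm0.
split; last exact: PhiPsi.
exists 0 => _ [m ->]; rewrite PhiPsi /dN /dscl mulVg.
by apply: (@scl_le_prodn _ _ _ 0) => //; apply: prodn1.
Qed.

End Rounding.

End CoarseKernel.

Lemma coarse_kernel_exists (G : groupType) (L N : G -> Prop) (l : nat) :
  is_normal L -> is_normal N -> (forall x, N x -> L x) ->
  (forall g x, L x -> N (comm g x)) -> dimW L N l ->
  exists (Phi : G -> Zl l) (Psi : Zl l -> G), coarse_kernel_maps L N Phi Psi.
Proof.
move=> nL nN NL LN /(dual_basis nL nN NL LN)[nu [b [C [ss [q hb hss dual span]]]]].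
have [D d] := QG_defects q.
have [k [_ hk]] := archi_nat (2 * psi_error C D ss + 1).
eexists; eexists.
exact: (Phi_Psi_coarse_kernel nL nN NL LN q d (fun i => (hb i).1) (fun i => (hb i).2)
  hss dual span hk).
Qed.

(** For [x = a * b], [comm_mulr] splits [comm g x] into [comm g a], which lies in the next term of
    the lower central series, and a conjugate of [comm g b], which lies in [N] by normality. *)
Lemma lcs_comm_in (G : groupType) (L N : G -> Prop) (q : nat) :
  is_normal N -> (2 <= q)%N ->
  ((forall x, N x <-> gamma q x) /\ (forall x, L x <-> gamma q.-1 x)
   \/
   ((forall x, gamma q x -> N x) /\
    (forall x, L x <-> exists a b, gamma q.-1 a /\ N b /\ x = (a * b)%g) /\
    has_presentation_in_gamma G q)) ->
  forall g x, L x -> N (comm g x).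
Proof.
(* For [q] of the form [q.+2], [gamma q.+2] computes to [commGN (gamma q.+1)]; the truncated
   predecessor in [gamma] would identify the indices 0 and 1. *)
move=> nN; have [[_ [NM NV]] NJ] := nN; case: q => [|[|q]] //= _ h g x Lx.
have hgamma a : gamma q.+1 a -> gamma q.+2 (comm g a).
  by move=> ha; apply: gen_in; exists g, a.
case: h => [[NE LE]|[gN [LE _]]]; first by apply/NE/hgamma/LE.
have /LE[a [b [ha [Nb ->]]]] := Lx; rewrite comm_mulr; apply: (NM); first exact/gN/hgamma.
by apply: (NJ); apply: (NM); [apply: (NJ)|apply: (NV)].
Qed.

Theorem theoremA (G : groupType) (L N : G -> Prop) (q l : nat) :
  is_normal L -> is_normal N -> (forall x, N x -> L x) ->
  (2 <= q)%N ->
  ((forall x, N x <-> gamma q x) /\ (forall x, L x <-> gamma q.-1 x)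
   \/
   ((forall x, gamma q x -> N x) /\
    (forall x, L x <-> exists a b, gamma q.-1 a /\ N b /\ x = (a * b)%g) /\
    has_presentation_in_gamma G q)) ->
  dimW L N l ->
  let GN := commGN N in
  let dN := dscl N in
  let dL := dscl L in
  exists (Phi : G -> Zl l) (Psi : Zl l -> G),
    let Im := fun y => exists m, y = Psi m in
    (forall m, GN (Psi m)) /\
    (* (1) pre-coarse homomorphisms *)
    (exists C : RR, forall g g', GN g -> GN g' ->
        dZ (Phi (g * g')%g) (Phi g + Phi g') <= C) /\
    (exists C : RR, forall m m', dN (Psi (m + m')) (Psi m * Psi m')%g <= C) /\
    (* (2) *)
    dbounded dL Im /\
    (* (3) *)
    qi_embedding_on (fun _ => True) (@dZ l) dN Psi /\
    (* (4) *)
    (forall A : G -> Prop, (forall y, A y -> GN y) -> dbounded dL A ->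
        qi_embedding_on A dN (@dZ l) Phi) /\
    (* (5) *)
    (forall A : G -> Prop, (forall y, A y -> GN y) -> dbounded dL A ->
        exists C : RR, forall y, A y -> dN y (Psi (Phi y)) <= C) /\
    (* (6) *)
    (exists C : RR, forall m, norm1 (Phi (Psi m) - m) <= C) /\
    (* (7) Psi(Z^l) represents the coarse kernel of iota_(G,L,N) *)
    (dbounded dL Im /\
     forall B : G -> Prop, (forall y, B y -> GN y) -> dbounded dL B ->
       exists D : RR, 0 <= D /\ forall b, B b -> forall eps : RR, 0 < eps ->
         exists a, Im a /\ dN a b <= D + eps) /\
    (* in particular: mutually coarse inverse coarse isomorphisms *)
    controlled_on (fun _ => True) (@dZ l) dN Psi /\
    controlled_on Im dN (@dZ l) Phi /\
    (exists C : RR, forall m, dZ (Phi (Psi m)) m <= C) /\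
    (exists C : RR, forall y, Im y -> dN (Psi (Phi y)) y <= C) /\
    (* furthermore *)
    (forall m, Phi (Psi m) = m).
Proof.
move=> nL nN NL q2 hq hW.
exact: coarse_kernel_exists nL nN NL (lcs_comm_in nN q2 hq) hW.
Qed.
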